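(* Let $R$ be a commutative ring with $1$. For any $R$-module $M$ there is a natural exact sequence of $R$-modules $$\mathrm{Tor}_1^R((R/2R)^{[1]},M)\xrightarrow{\ \tau\ }\mathrm{Sym}^2_R(M)/\mathrm{Im}(d)\xrightarrow{\ \bar w\ }\Gamma^2_R(M)\xrightarrow{\ \rho\ }(R/2R)^{[1]}\otimes M\to 0,$$ where the connecting homomorphism $\tau$ is explicitly given as follows. Let $M_1\xrightarrow{u_1}M_0\xrightarrow{u_0}M\to0$ be a partial free resolution of $M$ (exact, with $M_0,M_1$ free), let $(e_i)_{i\in I}$ and $(e'_j)_{j\in J}$ be bases of $M_0$ and $M_1$ respectively, with $I$ totally ordered, and let $u_1$ be represented by the matrix $(a_{ij})_{(i,j)\in I\times J}$, i.e. $u_1(e'_j)=\sum_i a_{ij}e_i$, $a_{ij}\in R$. Let $x=\sum_j\bar r_j\otimes e'_j\in\mathrm{Ker}\bigl(1\otimes u_1:(R/2R)^{[1]}\otimes M_1\to(R/2R)^{[1]}\otimes M_0\bigr)$, $r_j\in R$, and let $[x]$ be its class in $\mathrm{Tor}_1^R((R/2R)^{[1]},M)$. Then for all $i\in I$ there exists $s_i\in R$ such that $\sum_j r_ja_{ij}^2=2s_i$, and $$\tau[x]=\sum_i s_i\,u_0(e_i)^2+\sum_j\sum_{i_1<i_2}r_j\,a_{i_1j}\,a_{i_2j}\,u_0(e_{i_1})u_0(e_{i_2})+\mathrm{Im}(d).$$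
   Context: $\otimes$ means $\otimes_R$. For an $R$-module $N$ with $2N=0$, the right Frobenius twist $N^{[1]}$ is the $R$-bimodule whose left $R$-action is the given one on $N$ and whose right action is $n\cdot r=r^2n$ for $r\in R$, $n\in N$; tensor products and Tor of $N^{[1]}$ with an $R$-module are formed using this right action, and are regarded as $R$-modules via the left action. ${}_2R=\{r\in R\mid 2r=0\}$. $\mathrm{Sym}^2_R(M)$ is the symmetric tensor square, with generators $xy$. $\Gamma^2_R(M)$ is the degree $2$ component of the divided power algebra over $M$: the $R$-module generated by $\gamma_2(x)$ and symbols $\gamma_1(x)\gamma_1(y)$, $R$-bilinear in $x,y\in M$, with relations $\gamma_2(x+y)=\gamma_2(x)+\gamma_2(y)+\gamma_1(x)\gamma_1(y)$ and $\gamma_2(rx)=r^2\gamma_2(x)$. The map $d:({}_2R)^{[1]}\otimes M\to\mathrm{Sym}^2_R(M)$ is the $R$-linear map $d(r\otimes x)=rx^2$. The map $w:\mathrm{Sym}^2_R(M)\to\Gamma^2_R(M)$ is the $R$-linear map $w(xy)=\gamma_1(x)\gamma_1(y)=\gamma_2(x+y)-\gamma_2(x)-\gamma_2(y)$; it vanishes on $\mathrm{Im}(d)$ and $\bar w$ is the induced map. The map $\rho$ is the $R$-linear map with $\rho(\gamma_2(x))=\bar1\otimes x$. *)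

(* Defs.v *)
From HB Require Import structures.
From mathcomp Require Import all_boot all_order all_algebra.
From mathcomp Require Import generic_quotient ring_quotient finmap.
From mathcomp Require Import boolp classical_sets functions cardinality fsbigop.

Set Implicit Arguments.
Unset Strict Implicit.
Unset Printing Implicit Defensive.
Import GRing.Theory.
Local Open Scope ring_scope.
Local Open Scope classical_set_scope.
Local Open Scope quotient_scope.

Definition exact_at (U : Type) (V W : nmodType) (f : U -> V) (g : V -> W) : Prop :=
  range f = [set v | g v = 0].

Definition onto (U V : Type) (f : U -> V) : Prop := forall v, exists u, f u = v.

Section Kernel.
Context (R : pzRingType) (U V : lmodType R) (f : {linear U -> V}).

Definition ker_pred : {pred U} := fun u => f u == 0.

Lemma ker_submod_closed : submod_closed ker_pred.
Proof.
split; first by rewrite unfold_in /ker_pred linear0.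
move=> a u v; rewrite !unfold_in /ker_pred => /eqP fu /eqP fv.
by rewrite linearP fu fv scaler0 addr0.
Qed.

HB.instance Definition _ :=
  GRing.isSubmodClosed.Build R U ker_pred ker_submod_closed.

Record kermod := Kermod { kval : U; _ : kval \in ker_pred }.

HB.instance Definition _ := [isSub for kval].
HB.instance Definition _ := [Choice of kermod by <:].
HB.instance Definition _ := [SubChoice_isSubLmodule of kermod by <:].

Lemma kvalP (z : kermod) : f (kval z) = 0.
Proof. by apply/eqP; exact: (valP z). Qed.

Lemma kval_is_linear : linear kval. Proof. by []. Qed.
HB.instance Definition _ := GRing.isLinear.Build R kermod U _ kval kval_is_linear.

Lemma mem_ker u : f u = 0 -> u \in ker_pred.
Proof. by move=> fu; apply/eqP. Qed.

Definition mkker u (fu : f u = 0) : kermod := Kermod (mem_ker fu).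

End Kernel.

Section KernelMap.
Context (R : pzRingType) (U V U' V' : lmodType R).
Context (f : {linear U -> V}) (f' : {linear U' -> V'}).
Context (a : {linear U -> U'}) (b : {linear V -> V'}).
Hypothesis fa : f' \o a =1 b \o f.

Lemma ker_map_subproof (z : kermod f) : f' (a (kval z)) = 0.
Proof. by rewrite [LHS](fa (kval z)) /= kvalP linear0. Qed.

Definition ker_map (z : kermod f) : kermod f' := mkker (ker_map_subproof z).

Lemma ker_map_is_linear : linear ker_map.
Proof.
move=> k x y; apply/val_inj.
rewrite [LHS](_ : _ = a (k *: kval x + kval y)) //.
by rewrite linearP.
Qed.
HB.instance Definition _ :=
  GRing.isLinear.Build R (kermod f) (kermod f') _ ker_map ker_map_is_linear.

End KernelMap.

Section Quotient.
Context (R : pzRingType) (V : lmodType R) (S : set V).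

Definition submodule (A : set V) : Prop :=
  A 0 /\ forall a u v, A u -> A v -> A (a *: u + v).

Definition gen_pred : {pred V} := fun v => `[< smallest submodule S v >].

Lemma gen_submod_closed : submod_closed gen_pred.
Proof.
split; first by apply/asboolP => A [[]].
move=> a u v /asboolP Hu /asboolP Hv; apply/asboolP => A [sA SA].
by case: (sA) => _; apply; [apply: Hu | apply: Hv].
Qed.

HB.instance Definition _ :=
  GRing.isSubmodClosed.Build R V gen_pred gen_submod_closed.

Definition quomod := Quotient.quot gen_pred.
HB.instance Definition _ := GRing.Zmodule.on quomod.

Definition qpi (v : V) : quomod := \pi_(Quotient.quot gen_pred) v.

Lemma qpi_is_additive : zmod_morphism qpi.
Proof. by move=> u v; rewrite /qpi -raddfB. Qed.
HB.instance Definition _ :=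
  GRing.isZmodMorphism.Build V quomod qpi qpi_is_additive.

Lemma qpiP (q : quomod) : exists v, qpi v = q.
Proof. by exists (repr q); rewrite /qpi reprK. Qed.

Lemma qpi_eq u v : qpi u = qpi v <-> u - v \in gen_pred.
Proof. by rewrite Quotient.idealrBE; split=> [/eqP|/eqP]. Qed.

Lemma qpi_eq0 v : qpi v = 0 <-> smallest submodule S v.
Proof.
have -> : (qpi v = 0) = (qpi v = qpi 0) by rewrite raddf0.
rewrite qpi_eq subr0; split=> [/asboolP|H] //; exact/asboolP.
Qed.

Lemma qpi_rel v : S v -> qpi v = 0.
Proof. by move=> Sv; apply/qpi_eq0; exact: sub_gen_smallest. Qed.

Definition qscale (a : R) (q : quomod) : quomod := qpi (a *: repr q).

Lemma qscaleE a v : qscale a (qpi v) = qpi (a *: v).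
Proof.
apply/qpi_eq; rewrite -scalerBr rpredZ //.
by apply/qpi_eq; rewrite /qpi reprK.
Qed.

Lemma qscaleA a b q : qscale a (qscale b q) = qscale (a * b) q.
Proof. by have [v <-] := qpiP q; rewrite !qscaleE scalerA. Qed.
Lemma qscale1 : left_id 1 qscale.
Proof. by move=> q; have [v <-] := qpiP q; rewrite qscaleE scale1r. Qed.
Lemma qscaleDr : right_distributive qscale +%R.
Proof.
move=> a p q; have [u <-] := qpiP p; have [v <-] := qpiP q.
by rewrite -raddfD !qscaleE scalerDr raddfD.
Qed.
Lemma qscaleDl q : {morph qscale^~ q : a b / a + b}.
Proof.
by move=> a b /=; have [v <-] := qpiP q; rewrite !qscaleE scalerDl raddfD.
Qed.

HB.instance Definition _ := GRing.Zmodule_isLmodule.Build R quomod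
  qscaleA qscale1 qscaleDr qscaleDl.

Lemma qpi_is_scalable : scalable qpi.
Proof. by move=> a v; rewrite -qscaleE. Qed.
HB.instance Definition _ := GRing.isScalable.Build R V quomod _ qpi qpi_is_scalable.

Section Lift.
Context (W : lmodType R) (f : {linear V -> W}).
Implicit Type fS : forall v, S v -> f v = 0.

Definition quo_lift fS (q : quomod) : W := f (repr q).

Lemma quo_liftE fS v : quo_lift fS (qpi v) = f v.
Proof.
apply/eqP; rewrite -subr_eq0 -linearB; apply/eqP.
have : smallest submodule S (repr (qpi v) - v).
  by apply/asboolP; apply/qpi_eq; rewrite /qpi reprK.
apply: (_ : smallest submodule S `<=` [set u | f u = 0]); apply: smallest_sub => //.
by split=> [|a x y /= fx fy]; rewrite /= ?linear0 // linearP fx fy scaler0 addr0.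
Qed.

Lemma quo_lift_is_linear fS : linear (quo_lift fS).
Proof.
move=> a p q; have [u <-] := qpiP p; have [v <-] := qpiP q.
by rewrite -linearP !quo_liftE linearP.
Qed.
HB.instance Definition _ fS :=
  GRing.isLinear.Build R quomod W _ (quo_lift fS) (quo_lift_is_linear fS).

End Lift.
End Quotient.
Arguments quo_lift {R V S W f} fS q.

Definition fin_supp (X : Type) (V : nmodType) (f : X -> V) : Prop :=
  finite_set [set x | f x <> 0].

Section Free.
Context (R : pzRingType) (X : choiceType).

Definition fin_supp_pred : {pred X -> R^o} := fun f => `[< fin_supp f >].

Lemma fin_supp_submod_closed : submod_closed fin_supp_pred.
Proof.
split.
  apply/asboolP; apply: (sub_finite_set _ (finite_set0 X)).
  by move=> x /=; apply.
move=> a f g /asboolP ff /asboolP fg; apply/asboolP.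
have fU : finite_set ([set x | f x <> 0] `|` [set x | g x <> 0]).
  by rewrite finite_setU.
apply: sub_finite_set fU.
move=> x /= nz; case: (pselect (f x = 0)) => [f0|]; [right=> g0|by left].
apply: nz.
by rewrite (_ : (a *: f + g) x = a *: f x + g x)// f0 g0 scaler0 addr0.
Qed.

HB.instance Definition _ :=
  GRing.isSubmodClosed.Build R (X -> R^o) fin_supp_pred fin_supp_submod_closed.

(* the free module R^(X) of finitely supported functions *)
Record freemod := Freemod { fval : X -> R^o; _ : fval \in fin_supp_pred }.

HB.instance Definition _ := [isSub for fval].
HB.instance Definition _ := [Choice of freemod by <:].
HB.instance Definition _ := [SubChoice_isSubLmodule of freemod by <:].

Definition coef (c : freemod) (x : X) : R := fval c x.
Coercion coef : freemod >-> Funclass.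

Lemma coefP (c : freemod) : fin_supp c.
Proof. by have /asboolP := valP c. Qed.

Lemma fgen_subproof (x : X) :
  (fun y => if y == x then 1 else 0 : R^o) \in fin_supp_pred.
Proof.
apply/asboolP; apply: (sub_finite_set _ (finite_set1 x)) => y /=.
by case: eqP.
Qed.

Definition fgen (x : X) : freemod := Freemod (fgen_subproof x).

Section Lift.
Context (V : lmodType R) (e : X -> V).

Definition free_lift (c : freemod) : V := \sum_(x \in [set: X]) c x *: e x.

Lemma free_lift_sub (c : freemod) (A : {fset X}) :
  [set x | c x <> 0] `<=` [set` A] -> free_lift c = \sum_(x <- A) c x *: e x.
Proof.
move=> cA; apply: fsbigTE => x xA.
by rewrite (_ : c x = 0) ?scale0r //; apply: contrapT => /cA /=; apply/negP.
Qed.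

Lemma free_lift_is_linear : linear free_lift.
Proof.
move=> a c d.
have [A cA] : exists A : {fset X}, [set x | c x <> 0] = [set` A].
  by apply/finite_fsetP; exact: coefP.
have [B dB] : exists B : {fset X}, [set x | d x <> 0] = [set` B].
  by apply/finite_fsetP; exact: coefP.
have cE : forall x, (a *: c + d) x = a * c x + d x by [].
rewrite !(@free_lift_sub _ (A `|` B)%fset) ?cA ?dB.
- rewrite scaler_sumr -big_split /=; apply: eq_bigr => x _.
  by rewrite [LHS](_ : _ = (a * c x + d x) *: e x) // scalerDl scalerA.
- by move=> x /= xB; rewrite in_fsetU xB orbT.
- by move=> x /= xA; rewrite in_fsetU xA.
- move=> x /= nz; rewrite in_fsetU; apply/orP.
  case: (pselect (c x = 0)) => [c0|nc]; last first.
    by left; have : [set` A] x by rewrite -cA.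
  right; have : [set` B] x; last by [].
  by rewrite -dB => d0; apply: nz; apply: (etrans (cE x)); rewrite c0 d0 mulr0 addr0.
Qed.
HB.instance Definition _ :=
  GRing.isLinear.Build R freemod V _ free_lift free_lift_is_linear.

Lemma free_liftE x : free_lift (fgen x) = e x.
Proof.
rewrite (@free_lift_sub _ [fset x]%fset).
  by rewrite big_seq_fset1 /= eqxx scale1r.
by move=> y /=; case: eqP => // -> _; rewrite in_fset1.
Qed.

End Lift.
End Free.
Arguments fgen {R X} x.

Section FreeTheory.
Context (R : pzRingType) (X : choiceType).

Lemma free_gen (c : freemod R X) : free_lift (@fgen R X) c = c.
Proof.
have [A cA] : exists A : {fset X}, [set x | c x <> 0] = [set` A].
  by apply/finite_fsetP; exact: coefP.
rewrite (@free_lift_sub _ _ _ _ _ A) ?cA //.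
apply/val_inj/funext => y.
have coefD (b d : freemod R X) : val (b + d) y = val b y + val d y by [].
have coefs (s : seq X) (F : X -> freemod R X) :
    val (\sum_(x <- s) F x) y = \sum_(x <- s) val (F x) y.
  by elim: s => [|x s IH]; rewrite ?big_nil // !big_cons coefD IH.
rewrite coefs (eq_bigr (fun x => if x == y then c y : R^o else 0)); last first.
  move=> x _; rewrite [LHS](_ : _ = c x * (if y == x then 1 else 0)) //.
  by rewrite eq_sym; case: eqP => [->|_]; rewrite ?mulr1 ?mulr0.
case: (pselect (c y = 0)) => [cy0|cy].
  rewrite big1 => [|x _]; last by rewrite cy0; case: eqP.
  by rewrite [RHS](_ : _ = c y).
have yA : y \in A by have : [set` A] y by rewrite -cA.
rewrite (big_fsetD1 y) //= eqxx big_seq big1 ?addr0 // => x.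
by rewrite !inE => /andP[/negPf-> _].
Qed.

Lemma free_ext (V : lmodType R) (f g : {linear freemod R X -> V}) :
  (forall x, f (fgen x) = g (fgen x)) -> f =1 g.
Proof.
move=> fg c; rewrite -(free_gen c).
have [A cA] : exists A : {fset X}, [set x | c x <> 0] = [set` A].
  by apply/finite_fsetP; exact: coefP.
rewrite (@free_lift_sub _ _ _ _ _ A) ?cA //.
by rewrite !linear_sum; apply: eq_bigr => x _; rewrite !linearZ /= fg.
Qed.

End FreeTheory.

Definition is_basis (R : pzRingType) (X : choiceType) (V : lmodType R)
  (e : X -> V) : Prop := bijective (free_lift e).

Section Presentation.
Context (R : pzRingType) (X : choiceType) (rel : set (freemod R X)).
Context (V : lmodType R).

Definition pgen (x : X) : quomod rel := qpi rel (fgen x).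

Lemma pres_ext (f g : {linear quomod rel -> V}) :
  (forall x, f (pgen x) = g (pgen x)) -> f =1 g.
Proof.
move=> fg q; have [c <-] := qpiP q.
exact: (@free_ext _ _ _ (f \o qpi rel) (g \o qpi rel)).
Qed.

Lemma quo_ext (U : lmodType R) (S : set U) (f g : {linear quomod S -> V}) :
  (forall u, f (qpi S u) = g (qpi S u)) -> f =1 g.
Proof. by move=> fg q; have [c <-] := qpiP q. Qed.

End Presentation.
Arguments pgen {R X rel} x.

Record bimod (R : comPzRingType) := Bimod {
  lmod :> lmodType R;
  ract : lmod -> R -> lmod;
  ractDl : forall m n a, ract (m + n) a = ract m a + ract n a;
  ractDr : forall n a b, ract n (a + b) = ract n a + ract n b;
  ract1 : forall n, ract n 1 = n;
  ractA : forall n a b, ract n (a * b) = ract (ract n a) b;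
  ractZ : forall a n b, ract (a *: n) b = a *: ract n b }.

Section Tensor.
Context (R : comPzRingType) (N : bimod R).

Section Def.
Context (M : lmodType R).

Inductive tens_rel : set (freemod R (N * M)%type) :=
| tens_relDl n n' m : tens_rel (fgen (n + n', m) - fgen (n, m) - fgen (n', m))
| tens_relDr n m m' : tens_rel (fgen (n, m + m') - fgen (n, m) - fgen (n, m'))
| tens_relB n a m : tens_rel (fgen (ract n a, m) - fgen (n, a *: m))
| tens_relZ a n m : tens_rel (fgen (a *: n, m) - a *: fgen (n, m)).

(* N (x)_R M, an R-module through the left action on N *)
Definition tens : lmodType R := quomod tens_rel.

Definition tmk (n : N) (m : M) : tens := pgen (n, m).

Lemma tmkDl n n' m : tmk (n + n') m = tmk n m + tmk n' m.
Proof.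
apply/eqP; rewrite -subr_eq0 opprD addrA -!linearB; apply/eqP.
by apply: qpi_rel; apply: tens_relDl.
Qed.
Lemma tmkDr n m m' : tmk n (m + m') = tmk n m + tmk n m'.
Proof.
apply/eqP; rewrite -subr_eq0 opprD addrA -!linearB; apply/eqP.
by apply: qpi_rel; apply: tens_relDr.
Qed.
Lemma tmkB n a m : tmk (ract n a) m = tmk n (a *: m).
Proof.
by apply/eqP; rewrite -subr_eq0 -!linearB; apply/eqP/qpi_rel; apply: tens_relB.
Qed.
Lemma tmkZ a n m : tmk (a *: n) m = a *: tmk n m.
Proof.
by apply/eqP; rewrite -subr_eq0 -linearZ -!linearB; apply/eqP/qpi_rel; apply: tens_relZ.
Qed.

Lemma tens_ext (V : lmodType R) (f g : {linear tens -> V}) :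
  (forall n m, f (tmk n m) = g (tmk n m)) -> f =1 g.
Proof. by move=> fg; apply: pres_ext => -[n m]; exact: fg. Qed.

Section Lift.
Context (V : lmodType R) (b : N -> M -> V).
Hypothesis bDl : forall n n' m, b (n + n') m = b n m + b n' m.
Hypothesis bDr : forall n m m', b n (m + m') = b n m + b n m'.
Hypothesis bB : forall n a m, b (ract n a) m = b n (a *: m).
Hypothesis bZ : forall a n m, b (a *: n) m = a *: b n m.

Lemma tens_lift_subproof z :
  tens_rel z -> free_lift (fun p => b p.1 p.2) z = 0.
Proof.
case=> [n n' m|n m m'|n a m|a n m]; rewrite !linearB ?linearZ /= !free_liftE /=.
- by rewrite bDl -addrA -opprD subrr.
- by rewrite bDr -addrA -opprD subrr.
- by rewrite bB subrr.
- by rewrite bZ scalerN subrr.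
Qed.

Definition tens_lift : tens -> V := quo_lift tens_lift_subproof.
Lemma tens_lift_is_linear : linear tens_lift.
Proof. by move=> a x y; rewrite /tens_lift linearP. Qed.
HB.instance Definition _ :=
  GRing.isLinear.Build R tens V _ tens_lift tens_lift_is_linear.

Lemma tens_liftE n m : tens_lift (tmk n m) = b n m.
Proof. exact: etrans (quo_liftE _ _) (free_liftE _ _). Qed.
End Lift.
End Def.

Section Map.
Context (M M' : lmodType R) (u : {linear M -> M'}).

Definition tens_map : tens M -> tens M'.
Proof.
refine (@tens_lift M (tens M') (fun n m => tmk n (u m)) _ _ _ _).
- by move=> n n' m; rewrite tmkDl.
- by move=> n m m'; rewrite linearD tmkDr.
- by move=> n a m; rewrite linearZ tmkB.
- by move=> a n m; rewrite tmkZ.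
Defined.
Lemma tens_map_is_linear : linear tens_map.
Proof. by move=> a x y; rewrite /tens_map linearP. Qed.
HB.instance Definition _ :=
  GRing.isLinear.Build R (tens M) (tens M') _ tens_map tens_map_is_linear.

Lemma tens_mapE n m : tens_map (tmk n m) = tmk n (u m).
Proof. exact: tens_liftE. Qed.
End Map.

Lemma tens_map_comp (M1 M2 M2' M3 : lmodType R)
    (f : {linear M1 -> M2}) (g : {linear M2 -> M3})
    (f' : {linear M1 -> M2'}) (g' : {linear M2' -> M3}) :
  g \o f =1 g' \o f' ->
  tens_map g \o tens_map f =1 tens_map g' \o tens_map f'.
Proof.
move=> gf; apply: (@tens_ext _ _ (_ \o _) (_ \o _)) => n m /=.
by rewrite !tens_mapE [X in tmk n X](gf m).
Qed.

End Tensor.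
Arguments tens_map {R} N {M M'} u _.
Arguments tens_ext {R N M V} f g _ _.

Section Twist.
Context (R : comPzRingType) (N : lmodType R) (N2 : forall n : N, n *+ 2 = 0).

(* N^[1]; right distributivity is where 2N = 0 is needed. *)
Definition frob : bimod R.
Proof.
refine (@Bimod R N (fun n r => r ^+ 2 *: n) _ _ _ _ _).
- by move=> m n a; rewrite scalerDr.
- by move=> n a b; rewrite sqrrD !scalerDl -mulr2n N2 addr0.
- by move=> n; rewrite expr1n scale1r.
- by move=> n a b; rewrite scalerA exprMn mulrC.
- by move=> a n b; rewrite !scalerA mulrC.
Defined.

End Twist.

Section ModTwo.
Context (R : comPzRingType).

Definition mul2 (r : R^o) : R^o := r *+ 2.
Lemma mul2_is_linear : linear mul2.
Proof. by move=> a x y; rewrite /mul2 mulrnDl scalerMnr. Qed.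
HB.instance Definition _ := GRing.isLinear.Build R R^o R^o _ mul2 mul2_is_linear.

Definition tors2 : lmodType R := kermod mul2.

Lemma tors2_mul2 (r : tors2) : r *+ 2 = 0.
Proof. by apply/val_inj; rewrite raddfMn; exact: (kvalP r). Qed.

Definition tors2_tw : bimod R := frob tors2_mul2.

Definition Rmod2 : lmodType R := quomod (range mul2).

Definition rmod2 (r : R) : Rmod2 := qpi (range mul2) r.

Lemma Rmod2_mul2 (r : Rmod2) : r *+ 2 = 0.
Proof.
have [a <-] := qpiP r; rewrite -raddfMn; apply: qpi_rel.
by exists a.
Qed.

Definition Rmod2_tw : bimod R := frob Rmod2_mul2.

End ModTwo.

Section Sym2.
Context (R : comPzRingType).

Section Def.
Context (M : lmodType R).

Inductive sym_rel : set (freemod R (M * M)%type) :=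
| sym_relD x y z : sym_rel (fgen (x + y, z) - fgen (x, z) - fgen (y, z))
| sym_relZ a x y : sym_rel (fgen (a *: x, y) - a *: fgen (x, y))
| sym_relC x y : sym_rel (fgen (x, y) - fgen (y, x)).

Definition sym2 : lmodType R := quomod sym_rel.

Definition smk (x y : M) : sym2 := pgen (x, y).

Lemma smkDl x y z : smk (x + y) z = smk x z + smk y z.
Proof.
apply/eqP; rewrite -subr_eq0 opprD addrA -!linearB; apply/eqP.
by apply: qpi_rel; apply: sym_relD.
Qed.
Lemma smkZl a x y : smk (a *: x) y = a *: smk x y.
Proof.
by apply/eqP; rewrite -subr_eq0 -linearZ -!linearB; apply/eqP/qpi_rel; apply: sym_relZ.
Qed.
Lemma smkC x y : smk x y = smk y x.
Proof.
by apply/eqP; rewrite -subr_eq0 -!linearB; apply/eqP/qpi_rel; apply: sym_relC.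
Qed.
Lemma smkDr x y z : smk x (y + z) = smk x y + smk x z.
Proof. by rewrite smkC smkDl !(smkC _ x). Qed.
Lemma smkZr a x y : smk x (a *: y) = a *: smk x y.
Proof. by rewrite smkC smkZl smkC. Qed.

Lemma sym2_ext (V : lmodType R) (f g : {linear sym2 -> V}) :
  (forall x y, f (smk x y) = g (smk x y)) -> f =1 g.
Proof. by move=> fg; apply: pres_ext => -[n m]; exact: fg. Qed.

Section Lift.
Context (V : lmodType R) (b : M -> M -> V).
Hypothesis bD : forall x y z, b (x + y) z = b x z + b y z.
Hypothesis bZ : forall a x y, b (a *: x) y = a *: b x y.
Hypothesis bC : forall x y, b x y = b y x.

Lemma sym2_lift_subproof z :
  sym_rel z -> free_lift (fun p => b p.1 p.2) z = 0.
Proof.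
case=> [x y z'|a x y|x y]; rewrite !linearB ?linearZ /= !free_liftE /=.
- by rewrite bD -addrA -opprD subrr.
- by rewrite bZ scalerN subrr.
- by rewrite bC subrr.
Qed.

Definition sym2_lift : sym2 -> V := quo_lift sym2_lift_subproof.
Lemma sym2_lift_is_linear : linear sym2_lift.
Proof. by move=> a x y; rewrite /sym2_lift linearP. Qed.
HB.instance Definition _ :=
  GRing.isLinear.Build R sym2 V _ sym2_lift sym2_lift_is_linear.

Lemma sym2_liftE x y : sym2_lift (smk x y) = b x y.
Proof. exact: etrans (quo_liftE _ _) (free_liftE _ _). Qed.
End Lift.

Definition dmap : tens (tors2_tw R) M -> sym2.
Proof.
refine (@tens_lift R (tors2_tw R) M sym2
          (fun r x => (kval r : R) *: smk x x) _ _ _ _).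
- by move=> r s x; rewrite -scalerDl.
- move=> r x y; rewrite !smkDl !smkDr (smkC y x) !scalerDr -!addrA.
  congr (_ + _); rewrite addrA -scalerDr -mulr2n -scalerMnr scalerMnl.
  by rewrite [_ *+ 2](kvalP r) scale0r add0r.
- move=> r a x; rewrite smkZl smkZr !scalerA; congr (_ *: _).
  by rewrite [LHS](_ : _ = a ^+ 2 * (kval r : R)) // expr2 mulrC mulrA.
- by move=> a r x; rewrite scalerA.
Defined.
Lemma dmap_is_linear : linear dmap.
Proof. by move=> a x y; rewrite /dmap linearP. Qed.
HB.instance Definition _ :=
  GRing.isLinear.Build R (tens (tors2_tw R) M) sym2 _ dmap dmap_is_linear.

Lemma dmapE (r : tors2 R) x :
  dmap (tmk (r : tors2_tw R) x) = (kval r : R) *: smk x x.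
Proof. exact: tens_liftE. Qed.

Definition sym2d : lmodType R := quomod (range dmap).

Definition spi : sym2 -> sym2d := qpi (range dmap).
Lemma spi_is_linear : linear spi.
Proof. by move=> a x y; rewrite /spi linearP. Qed.
HB.instance Definition _ :=
  GRing.isLinear.Build R sym2 sym2d _ spi spi_is_linear.

End Def.

Section Map.
Context (M M' : lmodType R) (g : {linear M -> M'}).

Definition sym2_map : sym2 M -> sym2 M'.
Proof.
refine (@sym2_lift M (sym2 M') (fun x y => smk (g x) (g y)) _ _ _).
- by move=> x y z; rewrite linearD smkDl.
- by move=> a x y; rewrite linearZ smkZl.
- by move=> x y; rewrite smkC.
Defined.
Lemma sym2_map_is_linear : linear sym2_map.
Proof. by move=> a x y; rewrite /sym2_map linearP. Qed.
HB.instance Definition _ :=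
  GRing.isLinear.Build R (sym2 M) (sym2 M') _ sym2_map sym2_map_is_linear.

Lemma sym2_mapE x y : sym2_map (smk x y) = smk (g x) (g y).
Proof. exact: sym2_liftE. Qed.

Lemma sym2_map_dmap : sym2_map \o @dmap M =1 @dmap M' \o tens_map (tors2_tw R) g.
Proof.
apply: (tens_ext (_ \o _) (_ \o _)) => r x /=.
by rewrite dmapE tens_mapE dmapE linearZ /= sym2_mapE.
Qed.

Lemma sym2d_map_subproof z :
  range (@dmap M) z -> (@spi M' \o sym2_map) z = 0.
Proof.
move=> [t _ <-]; rewrite /= [sym2_map _](sym2_map_dmap t).
by apply: qpi_rel; exists (tens_map (tors2_tw R) g t).
Qed.

Definition sym2d_map : sym2d M -> sym2d M' :=
  quo_lift sym2d_map_subproof.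
Lemma sym2d_map_is_linear : linear sym2d_map.
Proof. by move=> a x y; rewrite /sym2d_map linearP. Qed.
HB.instance Definition _ :=
  GRing.isLinear.Build R (sym2d M) (sym2d M') _ sym2d_map sym2d_map_is_linear.
End Map.
End Sym2.

Section Gamma2.
Context (R : comPzRingType).

Section Def.
Context (M : lmodType R).

(* inl x stands for gamma_2(x), inr (x, y) for gamma_1(x)gamma_1(y) *)
Inductive gam_rel : set (freemod R (M + M * M)%type) :=
| gam_relDl x y z :
    gam_rel (fgen (inr (x + y, z)) - fgen (inr (x, z)) - fgen (inr (y, z)))
| gam_relDr x y z :
    gam_rel (fgen (inr (x, y + z)) - fgen (inr (x, y)) - fgen (inr (x, z)))
| gam_relZl a x y : gam_rel (fgen (inr (a *: x, y)) - a *: fgen (inr (x, y)))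
| gam_relZr a x y : gam_rel (fgen (inr (x, a *: y)) - a *: fgen (inr (x, y)))
| gam_relD x y :
    gam_rel (fgen (inl (x + y)) - fgen (inl x) - fgen (inl y) - fgen (inr (x, y)))
| gam_relZ a x : gam_rel (fgen (inl (a *: x)) - a ^+ 2 *: fgen (inl x)).

Definition gam2 : lmodType R := quomod gam_rel.

Definition gamma2 (x : M) : gam2 := pgen (inl x).
Definition gamma11 (x y : M) : gam2 := pgen (inr (x, y)).

Lemma gamma11Dl x y z : gamma11 (x + y) z = gamma11 x z + gamma11 y z.
Proof.
apply/eqP; rewrite -subr_eq0 opprD addrA -!linearB; apply/eqP.
by apply: qpi_rel; apply: gam_relDl.
Qed.
Lemma gamma11Dr x y z : gamma11 x (y + z) = gamma11 x y + gamma11 x z.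
Proof.
apply/eqP; rewrite -subr_eq0 opprD addrA -!linearB; apply/eqP.
by apply: qpi_rel; apply: gam_relDr.
Qed.
Lemma gamma11Zl a x y : gamma11 (a *: x) y = a *: gamma11 x y.
Proof.
by apply/eqP; rewrite -subr_eq0 -linearZ -!linearB; apply/eqP/qpi_rel; apply: gam_relZl.
Qed.
Lemma gamma11Zr a x y : gamma11 x (a *: y) = a *: gamma11 x y.
Proof.
by apply/eqP; rewrite -subr_eq0 -linearZ -!linearB; apply/eqP/qpi_rel; apply: gam_relZr.
Qed.
Lemma gamma2D x y : gamma2 (x + y) = gamma2 x + gamma2 y + gamma11 x y.
Proof.
apply/eqP; rewrite -subr_eq0 !opprD !addrA -!linearB; apply/eqP.
by apply: qpi_rel; apply: gam_relD.
Qed.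
Lemma gamma2Z a x : gamma2 (a *: x) = a ^+ 2 *: gamma2 x.
Proof.
by apply/eqP; rewrite -subr_eq0 -linearZ -!linearB; apply/eqP/qpi_rel; apply: gam_relZ.
Qed.

Lemma gamma11E x y : gamma11 x y = gamma2 (x + y) - gamma2 x - gamma2 y.
Proof. by rewrite gamma2D -addrA -opprD addrAC subrr add0r. Qed.
Lemma gamma11C x y : gamma11 x y = gamma11 y x.
Proof. by rewrite !gamma11E (addrC y x) addrAC. Qed.
Lemma gamma11xx x : gamma11 x x = gamma2 x *+ 2.
Proof.
rewrite gamma11E -mulr2n -scaler_nat gamma2Z expr2 -natrM scaler_nat.
by rewrite (mulrnDr _ 2 2) mulr2n addrA !addrK.
Qed.

Lemma gam2_ext (V : lmodType R) (f g : {linear gam2 -> V}) :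
  (forall x, f (gamma2 x) = g (gamma2 x)) -> f =1 g.
Proof.
move=> fg; apply: pres_ext => -[x|[x y]]; first exact: fg.
by rewrite -/(gamma11 x y) gamma11E !linearB !fg.
Qed.

Section Lift.
Context (V : lmodType R) (q : M -> V) (b : M -> M -> V).
Hypothesis bDl : forall x y z, b (x + y) z = b x z + b y z.
Hypothesis bDr : forall x y z, b x (y + z) = b x y + b x z.
Hypothesis bZl : forall a x y, b (a *: x) y = a *: b x y.
Hypothesis bZr : forall a x y, b x (a *: y) = a *: b x y.
Hypothesis qD : forall x y, q (x + y) = q x + q y + b x y.
Hypothesis qZ : forall a x, q (a *: x) = a ^+ 2 *: q x.

Lemma gam2_lift_subproof z :
  gam_rel z ->
  free_lift (fun s => match s with inl x => q x | inr p => b p.1 p.2 end) z = 0.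
Proof.
case=> [x y z'|x y z'|a x y|a x y|x y|a x];
  rewrite !linearB ?linearZ /= !free_liftE /=.
- by rewrite bDl -addrA -opprD subrr.
- by rewrite bDr -addrA -opprD subrr.
- by rewrite bZl scalerN subrr.
- by rewrite bZr scalerN subrr.
- by rewrite qD -!addrA -!opprD !addrA subrr.
- by rewrite qZ scalerN subrr.
Qed.

Definition gam2_lift : gam2 -> V := quo_lift gam2_lift_subproof.
Lemma gam2_lift_is_linear : linear gam2_lift.
Proof. by move=> a x y; rewrite /gam2_lift linearP. Qed.
HB.instance Definition _ :=
  GRing.isLinear.Build R gam2 V _ gam2_lift gam2_lift_is_linear.

Lemma gam2_liftE x : gam2_lift (gamma2 x) = q x.
Proof. exact: etrans (quo_liftE _ _) (free_liftE _ _). Qed.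
End Lift.

Definition wmap : sym2 M -> gam2 :=
  sym2_lift gamma11Dl gamma11Zl gamma11C.
Lemma wmap_is_linear : linear wmap.
Proof. by move=> a x y; rewrite /wmap linearP. Qed.
HB.instance Definition _ :=
  GRing.isLinear.Build R (sym2 M) gam2 _ wmap wmap_is_linear.

Lemma wmapE x y : wmap (smk x y) = gamma11 x y.
Proof. exact: sym2_liftE. Qed.

Lemma wmap_dmap z : range (@dmap R M) z -> wmap z = 0.
Proof.
move=> [t _ <-]; pose o : {linear tens (tors2_tw R) M -> gam2} := \0.
apply: (tens_ext (wmap \o @dmap R M) o) => r x /=.
rewrite dmapE linearZ /= wmapE gamma11xx -scalerMnr scalerMnl.
by rewrite [_ *+ 2](kvalP r) scale0r.
Qed.

Definition wbar : sym2d M -> gam2 := quo_lift wmap_dmap.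
Lemma wbar_is_linear : linear wbar.
Proof. by move=> a x y; rewrite /wbar linearP. Qed.
HB.instance Definition _ :=
  GRing.isLinear.Build R (sym2d M) gam2 _ wbar wbar_is_linear.

Lemma wbarE z : wbar (spi z) = wmap z.
Proof. exact: quo_liftE. Qed.

(* The value 0 on gamma_1(x)gamma_1(y) is forced by gamma11E. *)
Definition rho : gam2 -> tens (Rmod2_tw R) M.
Proof.
refine (@gam2_lift (tens (Rmod2_tw R) M)
  (fun x => tmk (rmod2 1 : Rmod2_tw R) x) (fun _ _ => 0) _ _ _ _ _ _).
- by move=> *; rewrite addr0.
- by move=> *; rewrite addr0.
- by move=> *; rewrite scaler0.
- by move=> *; rewrite scaler0.
- by move=> x y; rewrite tmkDr addr0.
- by move=> a x; rewrite -tmkB /= tmkZ.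
Defined.
Lemma rho_is_linear : linear rho.
Proof. by move=> a x y; rewrite /rho linearP. Qed.
HB.instance Definition _ :=
  GRing.isLinear.Build R gam2 (tens (Rmod2_tw R) M) _ rho rho_is_linear.

Lemma rhoE x : rho (gamma2 x) = tmk (rmod2 1 : Rmod2_tw R) x.
Proof. exact: gam2_liftE. Qed.

End Def.

Section Map.
Context (M M' : lmodType R) (g : {linear M -> M'}).

Definition gam2_map : gam2 M -> gam2 M'.
Proof.
refine (@gam2_lift M (gam2 M') (fun x => gamma2 (g x))
  (fun x y => gamma11 (g x) (g y)) _ _ _ _ _ _).
- by move=> x y z; rewrite linearD gamma11Dl.
- by move=> x y z; rewrite linearD gamma11Dr.
- by move=> a x y; rewrite linearZ gamma11Zl.
- by move=> a x y; rewrite linearZ gamma11Zr.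
- by move=> x y; rewrite linearD gamma2D.
- by move=> a x; rewrite linearZ gamma2Z.
Defined.
Lemma gam2_map_is_linear : linear gam2_map.
Proof. by move=> a x y; rewrite /gam2_map linearP. Qed.
HB.instance Definition _ :=
  GRing.isLinear.Build R (gam2 M) (gam2 M') _ gam2_map gam2_map_is_linear.

Lemma gam2_mapE x : gam2_map (gamma2 x) = gamma2 (g x).
Proof. exact: gam2_liftE. Qed.
End Map.
End Gamma2.
Arguments wbar {R} M _.
Arguments rho {R} M _.

Section Tor.
Context (R : comPzRingType).

Section Resolution.
Context (M : lmodType R).

(* The functorial free resolution: F0 = R^(M), F1 = R^(Ker(F0 -> M)),
   F2 = R^(Ker(F1 -> F0)). *)
Definition F0 : lmodType R := freemod R M.
Definition aug : F0 -> M := free_lift id.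
Lemma aug_is_linear : linear aug.
Proof. by move=> a x y; rewrite /aug linearP. Qed.
HB.instance Definition _ :=
  GRing.isLinear.Build R F0 M _ aug aug_is_linear.
Definition F1 : lmodType R := freemod R (kermod aug).
Definition bd1 : F1 -> F0 := free_lift (@kval _ _ _ aug).
Lemma bd1_is_linear : linear bd1.
Proof. by move=> a x y; rewrite /bd1 linearP. Qed.
HB.instance Definition _ :=
  GRing.isLinear.Build R F1 F0 _ bd1 bd1_is_linear.
Definition F2 : lmodType R := freemod R (kermod bd1).
Definition bd2 : F2 -> F1 := free_lift (@kval _ _ _ bd1).
Lemma bd2_is_linear : linear bd2.
Proof. by move=> a x y; rewrite /bd2 linearP. Qed.
HB.instance Definition _ :=
  GRing.isLinear.Build R F2 F1 _ bd2 bd2_is_linear.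

End Resolution.
Arguments aug M _ : clear implicits.
Arguments bd1 M _ : clear implicits.
Arguments bd2 M _ : clear implicits.

Section ResolutionMap.
Context (M M' : lmodType R) (g : {linear M -> M'}).

Definition F0_map : F0 M -> F0 M' := free_lift (fun m => fgen (g m)).
Lemma F0_map_is_linear : linear F0_map.
Proof. by move=> a x y; rewrite /F0_map linearP. Qed.
HB.instance Definition _ :=
  GRing.isLinear.Build R (F0 M) (F0 M') _ F0_map F0_map_is_linear.

Lemma aug_nat : aug M' \o F0_map =1 g \o aug M.
Proof.
apply: (@free_ext _ _ _ (_ \o _) (_ \o _)) => m /=.
by rewrite /F0_map /aug !free_liftE.
Qed.

Definition F1_map : F1 M -> F1 M' :=
  free_lift (fun k => fgen (ker_map aug_nat k)).
Lemma F1_map_is_linear : linear F1_map.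
Proof. by move=> a x y; rewrite /F1_map linearP. Qed.
HB.instance Definition _ :=
  GRing.isLinear.Build R (F1 M) (F1 M') _ F1_map F1_map_is_linear.

Lemma bd1_nat : bd1 M' \o F1_map =1 F0_map \o bd1 M.
Proof.
apply: (@free_ext _ _ _ (_ \o _) (_ \o _)) => k /=.
by rewrite /F1_map /bd1 !free_liftE.
Qed.

Definition F2_map : F2 M -> F2 M' :=
  free_lift (fun k => fgen (ker_map bd1_nat k)).
Lemma F2_map_is_linear : linear F2_map.
Proof. by move=> a x y; rewrite /F2_map linearP. Qed.
HB.instance Definition _ :=
  GRing.isLinear.Build R (F2 M) (F2 M') _ F2_map F2_map_is_linear.

Lemma bd2_nat : bd2 M' \o F2_map =1 F1_map \o bd2 M.
Proof.
apply: (@free_ext _ _ _ (_ \o _) (_ \o _)) => k /=.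
by rewrite /F2_map /bd2 !free_liftE.
Qed.

End ResolutionMap.

Section Tor1.
Context (N : bimod R).

Definition tor1_bound (M : lmodType R) : set (kermod (tens_map N (bd1 M))) :=
  [set z | exists y, kval z = tens_map N (bd2 M) y].

Definition tor1 (M : lmodType R) : lmodType R := quomod (@tor1_bound M).

(* The class in Tor_1(N, M) of an element of Ker(1 (x) u1), where u1 : M1 -> M0
   is compared with F1 -> F0 through the chain map (f1, f0). *)
Section Class.
Context (M M0 M1 : lmodType R) (u1 : {linear M1 -> M0}).
Context (f0 : {linear M0 -> F0 M}) (f1 : {linear M1 -> F1 M}).
Hypothesis f10 : bd1 M \o f1 =1 f0 \o u1.

Definition tor1_class (x : kermod (tens_map N u1)) : tor1 M :=
  qpi (@tor1_bound M) (ker_map (tens_map_comp (N := N) f10) x).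

Lemma tor1_class_is_linear : linear tor1_class.
Proof. by move=> a x y; rewrite /tor1_class !linearP. Qed.
HB.instance Definition _ := GRing.isLinear.Build R
  (kermod (tens_map N u1)) (tor1 M) _ tor1_class tor1_class_is_linear.
End Class.

Section Map.
Context (M M' : lmodType R) (g : {linear M -> M'}).

Lemma tor1_map_subproof z : tor1_bound z -> tor1_class (bd1_nat g) z = 0.
Proof.
move=> [y zy]; apply: qpi_rel; exists (tens_map N (F2_map g) y) => /=.
by rewrite zy; apply/esym; exact: (tens_map_comp (N := N) (bd2_nat g) y).
Qed.

Definition tor1_map : tor1 M -> tor1 M' := quo_lift tor1_map_subproof.
Lemma tor1_map_is_linear : linear tor1_map.
Proof. by move=> a x y; rewrite /tor1_map linearP. Qed.
HB.instance Definition _ :=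
  GRing.isLinear.Build R (tor1 M) (tor1 M') _ tor1_map tor1_map_is_linear.
End Map.
End Tor1.

(* Comparison maps exist, so that quantifying over them is not vacuous. *)
Lemma comparison_exists (M M0 M1 : lmodType R) (u1 : {linear M1 -> M0})
    (u0 : {linear M0 -> M}) (I J : choiceType) (e : I -> M0) (e' : J -> M1) :
  exact_at u1 u0 -> is_basis e -> is_basis e' ->
  exists (f0 : {linear M0 -> F0 M}) (f1 : {linear M1 -> F1 M}),
    aug M \o f0 =1 u0 /\ bd1 M \o f1 =1 f0 \o u1.
Proof.
have ext (X : choiceType) (V W : lmodType R) (b : X -> V) (h : X -> W) :
    is_basis b -> exists f : {linear V -> W}, forall x, f (b x) = h x.
  move=> [c bK cK].
  have cl : linear (free_lift h \o c).
    move=> a x y /=; rewrite -linearP; congr (free_lift h _).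
    apply: (can_inj bK); rewrite cK; apply: esym; apply: etrans (linearP _ _ _ _) _.
    by rewrite /= !cK.
  pose m := GRing.isLinear.Build R V W _ (free_lift h \o c) cl.
  pose f : {linear V -> W} := HB.pack (free_lift h \o c) m.
  by exists f => x /=; rewrite -(free_liftE b) bK free_liftE.
have uniq (X : choiceType) (V W : lmodType R) (b : X -> V)
    (f g : {linear V -> W}) : is_basis b -> (forall x, f (b x) = g (b x)) -> f =1 g.
  move=> [c bK cK] fg v; rewrite -(cK v).
  apply: (@free_ext _ _ _ (f \o free_lift b) (g \o free_lift b)) => x /=.
  by rewrite !free_liftE.
move=> ex be be'.
have [f0 f0E] := ext _ _ _ e (fun i => fgen (u0 (e i)) : F0 M) be.
have augf0 : aug M \o f0 =1 u0.
  apply: (uniq _ _ _ e (_ \o _)) => // i /=; by rewrite f0E /aug free_liftE.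
have k0 j : aug M (f0 (u1 (e' j))) = 0.
  rewrite [LHS]augf0; have : range u1 (u1 (e' j)) by exists (e' j).
  by rewrite ex.
have [f1 f1E] := ext _ _ _ e' (fun j => fgen (mkker (k0 j)) : F1 M) be'.
exists f0, f1; split=> //.
apply: (uniq _ _ _ e' (_ \o _) (_ \o _)) => // j /=.
by rewrite f1E /bd1 free_liftE.
Qed.

End Tor.
Arguments aug {R} M _.
Arguments bd1 {R} M _.
Arguments bd2 {R} M _.
Arguments tor1_map {R} N {M M'} g _.
Arguments tor1_class {R N M M0 M1 u1 f0 f1} f10 x.

(* Main.v *)
From HB Require Import structures.
Require Import Defs.
From mathcomp Require Import all_boot all_order all_algebra.
From mathcomp Require Import finmap.
From mathcomp Require Import boolp classical_sets functions cardinality fsbigop.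
From mathcomp Require Import ring.

Set Implicit Arguments.
Unset Strict Implicit.
Unset Printing Implicit Defensive.
Import Order.TTheory GRing.Theory.
Local Open Scope ring_scope.
Local Open Scope classical_set_scope.

(** Write N for the twist of R/2R and S(M) for Sym^2(M)/Im(d).

    The sequence S(M) -> Gamma^2(M) -> N (x) M -> 0 is exact for every M: the
    rule r (x) x |-> r gamma2(x) is well defined modulo the image of w, since
    2 gamma2(x) = gamma11(x, x), and it inverts rho there
    ([exact_wbar_rho], [rho_onto]).  If M is free then moreover wbar is
    injective ([wbar_free_inj]): the functional
    gamma11(x, y) |-> x_i y_j + y_i x_j on Gamma^2 shows that if w kills
    sum c_ij e_i e_j then c_ij + c_ji = 0 for all i and j, so the sum reduces
    to the terms c_ii e_i^2 with 2 c_ii = 0, which lie in Im(d).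

    For a presentation M1 -> M0 -> M -> 0, with maps u1 and u0 and with M0 free,
    tau is then the connecting map of the snake lemma, and it is convenient to
    keep it as a relation ([connects]): z in N (x) M1 connects to q in S(M) when some y in
    Gamma^2(M1) lies over z, its image in Gamma^2(M0) is wbar(t), and t maps
    to q.  The relation is total on Ker(1 (x) u1), linear, and transported by
    morphisms of presentations ([connects_map]); it is single-valued as soon
    as wbar is injective on M0 ([connects_uniq]).  Hence on the functorial
    resolution it defines tau, and both the naturality of tau and its
    computation from an arbitrary presentation come from [connects_map].

    Exactness at S(M) ([ker_wbar_connects]) rests on the description of the
    kernel of Gamma^2(M0) -> Gamma^2(M) as the image of Gamma^2(M1) plus
    elements wbar(z), where z in S(M0) dies in S(M) ([gam2_map_ker]).

    The explicit formula is the expansion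
    sum_j r_j gamma2(sum_i a_ij e_i)
      = sum_i (sum_j r_j a_ij^2) gamma2(e_i)
        + sum_j sum_(i < k) r_j a_ij a_kj gamma11(e_i, e_k),
    in which 2 s_i gamma2(e_i) = w(s_i e_i^2) ([gamma2_comb]). *)

(** * Submodules, generators and quotients *)

Section Span.
Context (R : pzRingType).

Lemma image_submodule (U V : lmodType R) (f : {linear U -> V}) (S : set U) :
  submodule S -> submodule (f @` S).
Proof.
move=> [S0 SD]; split; first by exists 0; rewrite ?linear0.
move=> a _ _ [u Su <-] [v Sv <-]; exists (a *: u + v); first exact: SD.
by rewrite linearP.
Qed.

Lemma range_submodule (U V : lmodType R) (f : {linear U -> V}) :
  submodule (range f).
Proof. exact: image_submodule. Qed.

Lemma sum_submodule (V : lmodType R) (A B : set V) :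
  submodule A -> submodule B ->
  submodule [set w | exists u v, [/\ A u, B v & w = u + v]].
Proof.
move=> [A0 AD] [B0 BD]; split; first by exists 0, 0; rewrite addr0.
move=> a _ _ [u [v [Au Bv ->]]] [u' [v' [Au' Bv' ->]]].
exists (a *: u + u'), (a *: v + v'); split; [exact: AD | exact: BD |].
by rewrite scalerDr addrACA.
Qed.

Lemma ker_submodule (U V : lmodType R) (f : {linear U -> V}) :
  submodule [set u | f u = 0].
Proof.
split=> [|a u v /= fu fv]; first exact: linear0.
by rewrite linearP fu fv scaler0 addr0.
Qed.

Lemma preimage_submodule (U V : lmodType R) (f : {linear U -> V}) (S : set V) :
  submodule S -> submodule (f @^-1` S).
Proof.
move=> [S0 SD]; split=> [|a u v Su Sv]; first by rewrite /preimage /= linear0.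
by rewrite /preimage /= linearP; apply: SD.
Qed.

Lemma smallest_submodule_id (V : lmodType R) (S : set V) v :
  submodule S -> smallest (@submodule R V) S v -> S v.
Proof. by move=> sS; apply: (@smallest_sub _ (@submodule R V)). Qed.

(** Induction on generators: a submodule P containing them is the whole module
    because the quotient map by P agrees with 0 on them. *)
Lemma freemod_ind (X : choiceType) (P : set (freemod R X)) :
  submodule P -> (forall x, P (fgen x)) -> forall c, P c.
Proof.
move=> sP Pgen c; apply: smallest_submodule_id => //; apply/qpi_eq0.
pose o : {linear freemod R X -> quomod P} := \0.
by apply: (free_ext (f := qpi P) (g := o)) => x; apply: qpi_rel.
Qed.

Lemma pres_ind (X : choiceType) (rel : set (freemod R X))
    (P : set (quomod rel)) :
  submodule P -> (forall x, P (pgen x)) -> forall q, P q.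
Proof.
move=> sP Pgen q; apply: smallest_submodule_id => //; apply/qpi_eq0.
pose o : {linear quomod rel -> quomod P} := \0.
by apply: (pres_ext (f := qpi P) (g := o)) => x; apply: qpi_rel.
Qed.

Lemma qpiD (V : lmodType R) (S : set V) u v :
  qpi S (u + v) = qpi S u + qpi S v.
Proof. exact: raddfD. Qed.

Lemma qpiZ (V : lmodType R) (S : set V) a u : qpi S (a *: u) = a *: qpi S u.
Proof. exact: linearZ. Qed.

Lemma qpi_addr (V : lmodType R) (S : set V) u v : S v -> qpi S (u + v) = qpi S u.
Proof. by move=> Sv; rewrite qpiD (qpi_rel Sv) addr0. Qed.

Lemma exact_atI (U V W : lmodType R) (f : U -> V) (g : V -> W) :
  (forall u, g (f u) = 0) -> (forall v, g v = 0 -> exists u, f u = v) ->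
  exact_at f g.
Proof.
move=> gf0 kerg; apply/seteqP; split=> [_ [u _ <-] //|v /= /kerg[u <-]].
by exists u.
Qed.

End Span.

(** * Exactness at Gamma^2 and surjectivity of rho *)

Section RightExact.
Context (R : comPzRingType).

Section Fixed.
Context (M : lmodType R).

Lemma sym2_ind (P : set (sym2 M)) :
  submodule P -> (forall x y, P (smk x y)) -> forall z, P z.
Proof. by move=> sP Pg; apply: pres_ind => // -[x y]; apply: Pg. Qed.

Lemma sym2d_ext (V : lmodType R) (f g : {linear sym2d M -> V}) :
  (forall x y, f (spi (smk x y)) = g (spi (smk x y))) -> f =1 g.
Proof.
move=> fg; apply: quo_ext => z.
by apply: (sym2_ext (f := f \o @spi R M) (g := g \o @spi R M)).
Qed.

Lemma gamma2_0 : gamma2 (0 : M) = 0.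
Proof. by rewrite -(scale0r 0) gamma2Z expr0n /= scale0r. Qed.

Lemma wbar_smk x y : wbar M (spi (smk x y)) = gamma11 x y.
Proof. by rewrite wbarE wmapE. Qed.

(** The element is d(s (x) x), with s a 2-torsion scalar. *)
Lemma spi_tors2 (s : R) (x : M) : 2 * s = 0 -> spi (s *: smk x x) = 0.
Proof.
move=> s2; have ks : mul2 (s : R^o) = 0 by rewrite /mul2 -mulr_natl.
apply: qpi_rel; exists (tmk (mkker ks : tors2_tw R) x) => //.
by rewrite dmapE.
Qed.

Lemma rho_gamma11 x y : rho M (gamma11 x y) = 0.
Proof. exact: etrans (quo_liftE _ _) (free_liftE _ _). Qed.

Lemma rho_wbar z : rho M (wbar M z) = 0.
Proof.
pose o : {linear sym2d M -> tens (Rmod2_tw R) M} := \0.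
apply: (sym2d_ext (f := rho M \o wbar M) (g := o)) => x y.
exact: etrans (congr1 (rho M) (wbar_smk x y)) (rho_gamma11 x y).
Qed.

(** The canonical lifts along rho, used for surjectivity and for the explicit
    representative of a kernel element. *)
Lemma tmk_rmod2 r (x : M) :
  tmk (rmod2 r : Rmod2_tw R) x = rho M (r *: gamma2 x).
Proof.
have rE : (rmod2 r : Rmod2_tw R) = r *: (rmod2 1 : Rmod2_tw R).
  by rewrite /rmod2 -linearZ /= [_ *: _]mulr1.
by rewrite rE tmkZ linearZ /= rhoE.
Qed.

Lemma rho_onto : onto (rho M).
Proof.
move=> t; suff [y _ <-] : range (rho M) t by exists y.
apply: (pres_ind (range_submodule (rho M))) => -[n x].
have [r <-] := qpiP n.
by exists (r *: gamma2 x) => //; apply: esym (tmk_rmod2 r x).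
Qed.

Section RhoInverse.
Variable x : M.

Definition gamma2_line (r : R^o) : quomod (range (wbar M)) :=
  qpi (range (wbar M)) ((r : R) *: gamma2 x).
Lemma gamma2_line_is_linear : linear gamma2_line.
Proof. by move=> a r s; rewrite /gamma2_line -linearP scalerA -scalerDl. Qed.
HB.instance Definition _ := GRing.isLinear.Build R R^o
  (quomod (range (wbar M))) _ gamma2_line gamma2_line_is_linear.

(** 2 s gamma2(x) = s gamma11(x, x) = w(s x^2). *)
Lemma gamma2_line_mul2 r : range (@mul2 R) r -> gamma2_line r = 0.
Proof.
move=> [s _ <-]; apply: qpi_rel; exists (spi (s *: smk x x)) => //.
by rewrite !linearZ /= wbar_smk gamma11xx -scalerMnr scalerMnl.
Qed.
End RhoInverse.

(** The inverse of rho modulo Im(w) sends r (x) x to r gamma2(x): additivity in x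
    holds because the defect r gamma11(x, y) is in the image of w, and balance
    over the twisted right action is gamma2(a x) = a^2 gamma2(x). *)
Lemma rho_inverse :
  exists f : {linear tens (Rmod2_tw R) M -> quomod (range (wbar M))},
    forall y, f (rho M y) = qpi _ y.
Proof.
pose b (n : Rmod2_tw R) x := quo_lift (@gamma2_line_mul2 x) n.
have bE r x : b (qpi _ r) x = gamma2_line x r by exact: quo_liftE.
have bDl n n' x : b (n + n') x = b n x + b n' x by rewrite /b linearD.
have bDr n x y : b n (x + y) = b n x + b n y.
  have [r <-] := qpiP n; rewrite !bE /gamma2_line -qpiD gamma2D !scalerDr.
  apply: qpi_addr; exists (spi (r *: smk x y)) => //.
  by rewrite wbarE linearZ /= wmapE.
have bB n a x : b (ract n a) x = b n (a *: x).
  have [r <-] := qpiP n; have -> : ract (qpi _ r : Rmod2_tw R) a = qpi _ (a ^+ 2 *: r).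
    by rewrite qpiZ.
  by rewrite !bE /gamma2_line gamma2Z scalerA [_ *: _ : R^o]mulrC.
have bZ a n x : b (a *: n) x = a *: b n x by rewrite /b linearZ.
exists (tens_lift bDl bDr bB bZ).
apply: (gam2_ext (f := tens_lift bDl bDr bB bZ \o rho M)) => x /=.
apply: etrans (congr1 (tens_lift bDl bDr bB bZ) (rhoE x)) _.
apply: etrans (tens_liftE bDl bDr bB bZ _ _) _.
apply: etrans (bE 1 x) _.
by rewrite /gamma2_line scale1r.
Qed.

Lemma exact_wbar_rho : exact_at (wbar M) (rho M).
Proof.
apply: exact_atI rho_wbar _ => y ry.
have [f fE] := rho_inverse.
have /qpi_eq0 yw : qpi (range (wbar M)) y = 0 by rewrite -fE ry linear0.
by have [] := smallest_submodule_id (range_submodule _) yw => z _ <-; exists z.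
Qed.
End Fixed.
End RightExact.

(** * Functoriality *)

Section Functoriality.
Context (R : comPzRingType).

Lemma sym2d_mapE (M M' : lmodType R) (g : {linear M -> M'}) x y :
  sym2d_map g (spi (smk x y)) = spi (smk (g x) (g y)).
Proof.
apply: etrans (quo_liftE _ _) _.
by apply: (congr1 (@spi R M') (sym2_mapE g x y)).
Qed.

Lemma sym2d_map_spi (M M' : lmodType R) (g : {linear M -> M'}) z :
  sym2d_map g (spi z) = spi (sym2_map g z).
Proof. exact: etrans (quo_liftE _ _) _. Qed.

Lemma gam2_map_gamma11 (M M' : lmodType R) (g : {linear M -> M'}) x y :
  gam2_map g (gamma11 x y) = gamma11 (g x) (g y).
Proof. exact: etrans (quo_liftE _ _) (free_liftE _ _). Qed.

Section Square.
Context (M1 M2 M2' M3 : lmodType R).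
Context (f : {linear M1 -> M2}) (g : {linear M2 -> M3}).
Context (f' : {linear M1 -> M2'}) (g' : {linear M2' -> M3}).
Hypothesis gf : g \o f =1 g' \o f'.

Lemma gam2_map_comp : gam2_map g \o gam2_map f =1 gam2_map g' \o gam2_map f'.
Proof.
apply: (gam2_ext (f := gam2_map g \o gam2_map f)
                 (g := gam2_map g' \o gam2_map f')) => x /=.
rewrite (gam2_mapE f) (gam2_mapE f') (gam2_mapE g) (gam2_mapE g').
by rewrite [X in gamma2 X](gf x).
Qed.

Lemma sym2d_map_comp :
  sym2d_map g \o sym2d_map f =1 sym2d_map g' \o sym2d_map f'.
Proof.
apply: (sym2d_ext (f := sym2d_map g \o sym2d_map f)
                  (g := sym2d_map g' \o sym2d_map f')) => x y /=.
apply: etrans (congr1 (sym2d_map g) (sym2d_mapE f x y)) _.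
apply: etrans (sym2d_mapE g _ _) _.
apply: etrans _ (esym (congr1 (sym2d_map g') (sym2d_mapE f' x y))).
apply: etrans _ (esym (sym2d_mapE g' _ _)).
by congr (spi (smk _ _)); [apply: gf x | apply: gf y].
Qed.
End Square.

Lemma sym2d_map_id (M : lmodType R) : sym2d_map (idfun : M -> M) =1 id.
Proof.
apply: (sym2d_ext (f := sym2d_map idfun) (g := idfun)) => x y.
exact: sym2d_mapE.
Qed.

Lemma gam2_map_comp0 (M1 M2 M3 : lmodType R)
    (f : {linear M1 -> M2}) (g : {linear M2 -> M3}) :
  (forall x, g (f x) = 0) -> forall y, gam2_map g (gam2_map f y) = 0.
Proof.
move=> gf0; pose o : {linear gam2 M1 -> gam2 M3} := \0.
apply: (gam2_ext (f := gam2_map g \o gam2_map f) (g := o)) => x /=.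
by rewrite !gam2_mapE gf0 gamma2_0.
Qed.

Lemma sym2d_map_comp0 (M1 M2 M3 : lmodType R)
    (f : {linear M1 -> M2}) (g : {linear M2 -> M3}) :
  (forall x, g (f x) = 0) -> forall z, sym2d_map g (sym2d_map f z) = 0.
Proof.
move=> gf0; pose o : {linear sym2d M1 -> sym2d M3} := \0.
apply: (sym2d_ext (f := sym2d_map g \o sym2d_map f) (g := o)) => x y /=.
apply: etrans (congr1 (sym2d_map g) (sym2d_mapE f x y)) _.
apply: etrans (sym2d_mapE g _ _) _.
rewrite !gf0 -(scale0r 0) smkZl scale0r.
exact: raddf0 (@spi R M3).
Qed.

Section Natural.
Context (M M' : lmodType R) (g : {linear M -> M'}).

Lemma wbar_nat : gam2_map g \o wbar M =1 wbar M' \o sym2d_map g.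
Proof.
apply: (sym2d_ext (f := gam2_map g \o wbar M)
                  (g := wbar M' \o sym2d_map g)) => x y /=.
apply: etrans (congr1 (gam2_map g) (wbar_smk x y)) _.
apply: etrans (gam2_map_gamma11 g x y) _.
exact: esym (etrans (congr1 (wbar M') (sym2d_mapE g x y)) (wbar_smk _ _)).
Qed.

Lemma rho_nat : tens_map (Rmod2_tw R) g \o rho M =1 rho M' \o gam2_map g.
Proof.
apply: (gam2_ext (f := tens_map (Rmod2_tw R) g \o rho M)
                 (g := rho M' \o gam2_map g)) => x.
apply: etrans (congr1 (tens_map _ g) (rhoE x)) _.
apply: etrans (tens_mapE _ _ _) _.
exact: esym (etrans (congr1 (rho M') (gam2_mapE g x)) (rhoE (g x))).
Qed.

Hypothesis g_onto : onto g.

Lemma sym2d_map_onto : onto (sym2d_map g).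
Proof.
move=> q; suff [z _ <-] : range (sym2d_map g) q by exists z.
have [z <-] := qpiP q; move: z.
apply: (sym2_ind (P := @spi R M' @^-1` range (sym2d_map g))).
  exact: preimage_submodule (range_submodule _).
move=> x y; have [x' <-] := g_onto x; have [y' <-] := g_onto y.
by exists (spi (smk x' y')); rewrite // sym2d_mapE.
Qed.
End Natural.

End Functoriality.

(** * The kernel of Gamma^2 of a surjection *)

Section GammaKernel.
Context (R : comPzRingType) (M M0 M1 : lmodType R).
Context (u1 : {linear M1 -> M0}) (u0 : {linear M0 -> M}).
Hypotheses (u10 : exact_at u1 u0) (u0_onto : onto u0).

(** A candidate for the kernel of Gamma^2(u0), kept as a sum of two images so that
    it is visibly a submodule. *)
Definition gam2_ker_span : set (gam2 M0) :=
  [set y | exists v w, [/\ range (gam2_map u1) v,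
                           (wbar M0 @` [set z | sym2d_map u0 z = 0]) w &
                           y = v + w]].
Let K := gam2_ker_span.

Let gam2_ker_span_submodule : submodule K.
Proof.
exact: sum_submodule (range_submodule _) (image_submodule _ (ker_submodule _)).
Qed.

Let K0l w : (wbar M0 @` [set z | sym2d_map u0 z = 0]) w -> K w.
Proof.
move=> Kw; exists 0, w; split=> //; last by rewrite add0r.
by case: (range_submodule (gam2_map u1)).
Qed.

Let K0r v : range (gam2_map u1) v -> K v.
Proof.
move=> Kv; exists v, 0; split=> //; last by rewrite addr0.
by case: (image_submodule (wbar M0) (ker_submodule (sym2d_map u0))).
Qed.

Lemma gamma11_ker x y : u0 x = 0 -> K (gamma11 x y).
Proof.
move=> ux; apply: K0l; exists (spi (smk x y)); last exact: wbar_smk.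
apply: etrans (sym2d_mapE u0 x y) _.
rewrite ux -(scale0r 0) smkZl scale0r; exact: raddf0 (@spi R M).
Qed.

Lemma gamma2_ker x : u0 x = 0 -> K (gamma2 x).
Proof.
move=> ux; have [t _ tx] : range u1 x by rewrite u10.
by apply: K0r; exists (gamma2 t) => //; rewrite -tx; apply: gam2_mapE.
Qed.

(** Modulo K, gamma2 depends only on the image in M: a change x' + k with k in the
    kernel of u0 adds gamma2(k) + gamma11(x', k). *)
Lemma gamma2_mod x x' :
  u0 x = u0 x' -> qpi K (gamma2 x) = qpi K (gamma2 x').
Proof.
move=> xx'; have k0 : u0 (x - x') = 0 by rewrite linearB xx' subrr.
rewrite -[x in LHS](subrK x') gamma2D [_ + gamma2 x']addrC.
by rewrite !qpi_addr //; [apply: gamma2_ker | apply: gamma11_ker].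
Qed.

Lemma gamma11_mod x y x' y' : u0 x = u0 x' -> u0 y = u0 y' ->
  qpi K (gamma11 x y) = qpi K (gamma11 x' y').
Proof.
move=> xx' yy'; rewrite !gamma11E !(raddfB (qpi K)).
congr (_ - _ - _); apply: gamma2_mod => //.
by rewrite !linearD xx' yy'.
Qed.

(** Choosing preimages under u0 gives a map Gamma^2(M) -> Gamma^2(M0)/K; it is
    linear although the choice is not, by the two congruences above. *)
Lemma qpi_factors_gam2_map :
  exists f : {linear gam2 M -> quomod K}, forall y, f (gam2_map u0 y) = qpi K y.
Proof.
have [s sK] : {s : M -> M0 | forall x, u0 (s x) = x}.
  by exists (fun x => projT1 (cid (u0_onto x))) => x; case: cid.
pose q x := qpi K (gamma2 (s x)); pose b x y := qpi K (gamma11 (s x) (s y)).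
have bDl x y z : b (x + y) z = b x z + b y z.
  rewrite /b -qpiD -gamma11Dl; apply: gamma11_mod => //.
  by rewrite linearD !sK.
have bDr x y z : b x (y + z) = b x y + b x z.
  rewrite /b -qpiD -gamma11Dr; apply: gamma11_mod => //.
  by rewrite linearD !sK.
have bZl a x y : b (a *: x) y = a *: b x y.
  rewrite /b -qpiZ -gamma11Zl; apply: gamma11_mod => //.
  by rewrite linearZ /= !sK.
have bZr a x y : b x (a *: y) = a *: b x y.
  rewrite /b -qpiZ -gamma11Zr; apply: gamma11_mod => //.
  by rewrite linearZ /= !sK.
have qD x y : q (x + y) = q x + q y + b x y.
  have -> : q (x + y) = qpi K (gamma2 (s x + s y)).
    by apply: gamma2_mod; rewrite linearD !sK.
  by rewrite gamma2D !qpiD.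
have qZ a x : q (a *: x) = a ^+ 2 *: q x.
  rewrite /q -qpiZ -gamma2Z; apply: gamma2_mod.
  by rewrite linearZ /= !sK.
pose f := gam2_lift bDl bDr bZl bZr qD qZ.
exists f; apply: (gam2_ext (f := f \o gam2_map u0)) => x.
apply: etrans (congr1 f (gam2_mapE u0 x)) _.
apply: etrans (gam2_liftE bDl bDr bZl bZr qD qZ _) _.
by apply: gamma2_mod; rewrite sK.
Qed.

(** The quotient map by K factors through Gamma^2(u0). *)
Lemma gam2_map_ker y : gam2_map u0 y = 0 ->
  exists v z, y = gam2_map u1 v + wbar M0 z /\ sym2d_map u0 z = 0.
Proof.
move=> uy; have [f fE] := qpi_factors_gam2_map.
have /qpi_eq0 : qpi K y = 0 by apply: etrans (esym (fE y)) _; rewrite uy linear0.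
move/(smallest_submodule_id gam2_ker_span_submodule).
by move=> [_ [_ [[v _ <-] [z uz <-] ->]]]; exists v, z.
Qed.

End GammaKernel.

(** * Injectivity of wbar on free modules *)

(** Off-diagonal terms cancel in pairs; the induction on s peels one row and one
    column at a time. *)
Lemma skew_sum (R : pzRingType) (V : lmodType R) (X : Type) (c : X -> X -> R)
    (m : X -> X -> V) (s : seq X) :
  (forall i j, m i j = m j i) -> (forall i j, c i j + c j i = 0) ->
  \sum_(i <- s) \sum_(j <- s) c i j *: m i j = \sum_(i <- s) c i i *: m i i.
Proof.
move=> mC c0; elim: s => [|k s IH]; first by rewrite !big_nil.
rewrite !big_cons; under [X in _ + X]eq_bigr do rewrite big_cons.
rewrite big_split /= IH -addrA; congr (_ + _); rewrite addrA -big_split /=.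
rewrite [X in X + _]big1 ?add0r // => i _.
by rewrite [m i k]mC -scalerDl c0 scale0r.
Qed.

Section FreeInjective.
Context (R : comPzRingType) (X : choiceType).
Let F : lmodType R := freemod R X.

Lemma coef_is_linear (Y : choiceType) (y : Y) :
  linear (fun c : freemod R Y => c y : R^o).
Proof. by []. Qed.

Lemma coef_gen (Y : choiceType) (x y : Y) :
  (fgen x : freemod R Y) y = (y == x)%:R.
Proof. by rewrite -[LHS]/(if y == x then 1 else 0 : R^o); case: eqP. Qed.

(** Coordinates on Sym^2 of a free module by ordered pairs (i, j): redundant, but
    they avoid choosing an order on the basis. *)
Definition sym2_of_coef : freemod R (X * X)%type -> sym2 F :=
  free_lift (fun p => smk (fgen p.1 : F) (fgen p.2)).
Lemma sym2_of_coef_is_linear : linear sym2_of_coef.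
Proof. by move=> a c d; rewrite /sym2_of_coef linearP. Qed.
HB.instance Definition _ := GRing.isLinear.Build R (freemod R (X * X)%type)
  (sym2 F) _ sym2_of_coef sym2_of_coef_is_linear.

Lemma smk_linear_r (M : lmodType R) (x : M) : linear (smk x).
Proof. by move=> a u v; rewrite smkDr smkZr. Qed.

Lemma smk_linear_l (M : lmodType R) (x : M) : linear (fun u => smk u x).
Proof. by move=> a u v; rewrite /= smkDl smkZl. Qed.

Lemma sym2_of_coef_onto : onto sym2_of_coef.
Proof.
move=> z; suff [c _ <-] : range sym2_of_coef z by exists c.
have sR := range_submodule sym2_of_coef.
have smk_gen_l i y : range sym2_of_coef (smk (fgen i) y).
  pose m := GRing.isLinear.Build R F (sym2 F) _ _ (smk_linear_r (fgen i : F)).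
  pose f : {linear F -> sym2 F} := HB.pack (smk (fgen i : F)) m.
  apply: (freemod_ind (preimage_submodule f sR)) y => j.
  by exists (fgen (i, j)) => //; apply: free_liftE.
apply: (sym2_ind sR) => x y.
pose m := GRing.isLinear.Build R F (sym2 F) _ _ (smk_linear_l y).
pose f : {linear F -> sym2 F} := HB.pack (fun u : F => smk u y) m.
by apply: (freemod_ind (preimage_submodule f sR)) x => i; apply: smk_gen_l.
Qed.

(** The polarization of the quadratic map x |-> x_i x_j. *)
Lemma gam2_coef i j : exists f : {linear gam2 F -> R^o},
  forall x y, f (gamma11 x y) = x i * y j + y i * x j.
Proof.
pose q (x : F) : R^o := x i * x j; pose b (x y : F) : R^o := x i * y j + y i * x j.
have cD (x y : F) k : (x + y) k = x k + y k by [].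
have cZ a (x : F) k : (a *: x) k = a * x k by [].
have bDl x y z : b (x + y) z = b x z + b y z by rewrite /b !cD; ring.
have bDr x y z : b x (y + z) = b x y + b x z by rewrite /b !cD; ring.
have bZl a x y : b (a *: x) y = a *: b x y.
  by rewrite /b !cZ [RHS](_ : _ = a * (x i * y j + y i * x j)) //; ring.
have bZr a x y : b x (a *: y) = a *: b x y.
  by rewrite /b !cZ [RHS](_ : _ = a * (x i * y j + y i * x j)) //; ring.
have qD x y : q (x + y) = q x + q y + b x y by rewrite /q /b !cD; ring.
have qZ a x : q (a *: x) = a ^+ 2 *: q x.
  by rewrite /q !cZ [RHS](_ : _ = a ^+ 2 * (x i * x j)) //; ring.
exists (gam2_lift bDl bDr bZl bZr qD qZ) => x y.
exact: etrans (quo_liftE _ _) (free_liftE _ _).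
Qed.

(** The functional of [gam2_coef] applied to the image of c is c_ij + c_ji; for
    i = j this is the 2-torsion condition 2 c_ii = 0. *)
Lemma wmap_coef_skew (c : freemod R (X * X)%type) i j :
  wmap (sym2_of_coef c) = 0 -> c (i, j) + c (j, i) = 0.
Proof.
have [f fE] := gam2_coef i j.
pose G (c : freemod R (X * X)%type) : R^o := c (i, j) + c (j, i).
have Glin : linear G.
  by move=> a x y; rewrite /G [in RHS]scalerDr [RHS]addrACA.
pose mG := GRing.isLinear.Build R _ R^o _ G Glin.
pose G' : {linear freemod R (X * X)%type -> R^o} := HB.pack G mG.
have E : forall c, f (wmap (sym2_of_coef c)) = G c.
  apply: (free_ext (f := f \o (@wmap R F) \o sym2_of_coef) (g := G')) => -[k l].
  apply: etrans (congr1 (f \o @wmap R F) (free_liftE _ _)) _.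
  apply: etrans (congr1 f (wmapE _ _)) _.
  rewrite fE !coef_gen -[RHS]/(G (fgen (k, l))) /G !coef_gen !xpair_eqE -!natrM !mulnb.
  by rewrite [(i == l) && _]andbC.
by move=> wc; rewrite -[LHS]E wc linear0.
Qed.

(** By skew-symmetry only the terms c_ii e_i^2 with 2 c_ii = 0 survive, and they
    are in the image of d. *)
Lemma wbar_free_inj z : wbar F z = 0 -> z = 0.
Proof.
have [t <-] := qpiP z; have [c <-] := sym2_of_coef_onto t => wc.
have {}wc : wmap (sym2_of_coef c) = 0 by rewrite -wbarE.
have skew i j := wmap_coef_skew i j wc.
have [A cA] : exists A : {fset X * X}, [set p | c p <> 0] = [set` A].
  by apply/finite_fsetP; apply: coefP.
pose s := undup (map fst A ++ map snd A).
have us : uniq s by apply: undup_uniq.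
pose m i j := smk (fgen i : F) (fgen j).
suff -> : sym2_of_coef c = \sum_(i <- s) c (i, i) *: m i i.
  rewrite (raddf_sum (@spi R F)); apply: big1 => i _; apply: spi_tors2.
  by rewrite mulr_natl mulr2n skew.
have mC i j : m i j = m j i by apply: smkC.
rewrite -(skew_sum s mC skew).
rewrite -(big_allpairs (F := fun p => c p *: m p.1 p.2)).
have ua : uniq [seq (i, j) | i <- s, j <- s].
  by apply: allpairs_uniq => // -[? ?] -[? ?].
have c0 p : p \notin [seq (i, j) | i <- s, j <- s] -> c p = 0.
  move=> ps; apply: contrapT => cp; move/negP: ps; apply.
  have pA : p \in A by have : [set` A] p by rewrite -cA.
  case: p cp pA => i j _ pA; apply/allpairsP; exists (i, j); split=> //=.
    by rewrite mem_undup mem_cat; apply/orP; left; apply/mapP; exists (i, j).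
  by rewrite mem_undup mem_cat; apply/orP; right; apply/mapP; exists (i, j).
rewrite [RHS]fsbig_seq // [RHS](fsbig_widen _ [set: X * X]) //.
by move=> p [_ /= /negP/c0->]; rewrite scale0r.
Qed.
End FreeInjective.

(** * The connecting homomorphism *)

Section Connecting.
Context (R : comPzRingType).
Let N : bimod R := Rmod2_tw R.

Lemma linear_comb (U V : lmodType R) (f : {linear U -> V}) a u v u' v' :
  f u = u' -> f v = v' -> f (a *: u + v) = a *: u' + v'.
Proof. by move=> <- <-; rewrite linearP. Qed.

(** The snake relation between N (x) M1 and S(M).  A relation, unlike a map on
    Ker(1 (x) u1), makes sense before any lift is shown to be unique, and it is
    carried along every commutative ladder. *)
Definition connects (M M0 M1 : lmodType R) (u1 : {linear M1 -> M0})
    (u0 : {linear M0 -> M}) (z : tens N M1) (q : sym2d M) : Prop :=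
  exists y t, [/\ rho M1 y = z, gam2_map u1 y = wbar M0 t & sym2d_map u0 t = q].

(** Naturality of rho and wbar carries a pair (y, t) of witnesses to another. *)
Lemma connects_map (M M0 M1 M' M0' M1' : lmodType R)
    (u1 : {linear M1 -> M0}) (u0 : {linear M0 -> M})
    (u1' : {linear M1' -> M0'}) (u0' : {linear M0' -> M'})
    (f1 : {linear M1 -> M1'}) (f0 : {linear M0 -> M0'}) (g : {linear M -> M'}) :
  u1' \o f1 =1 f0 \o u1 -> u0' \o f0 =1 g \o u0 ->
  forall z q, connects u1 u0 z q ->
    connects u1' u0' (tens_map N f1 z) (sym2d_map g q).
Proof.
move=> sq1 sq0 z q [y [t [<- yt <-]]].
exists (gam2_map f1 y), (sym2d_map f0 t); split.
- exact: esym (rho_nat f1 y).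
- apply: etrans (gam2_map_comp sq1 y) _.
  apply: etrans (congr1 (gam2_map f0) yt) _.
  exact: wbar_nat.
- exact: sym2d_map_comp sq0 t.
Qed.

Section Fixed.
Context (M M0 M1 : lmodType R) (u1 : {linear M1 -> M0}) (u0 : {linear M0 -> M}).

Lemma connects_linear a z z' q q' : connects u1 u0 z q ->
  connects u1 u0 z' q' -> connects u1 u0 (a *: z + z') (a *: q + q').
Proof.
move=> [y [t [yz yt tq]]] [y' [t' [yz' yt' tq']]].
exists (a *: y + y'), (a *: t + t'); split.
- exact: (linear_comb (f := rho M1)).
- apply: etrans (linear_comb (f := gam2_map u1) _ yt yt') _.
  exact: esym (linear_comb (f := wbar M0) _ erefl erefl).
- exact: (linear_comb (f := sym2d_map u0)).
Qed.

Lemma connects_exists z : tens_map N u1 z = 0 -> exists q, connects u1 u0 z q.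
Proof.
move=> uz; have [y yz] := rho_onto z.
have : [set v | rho M0 v = 0] (gam2_map u1 y).
  rewrite /=; apply: etrans (esym (rho_nat u1 y)) _.
  exact: etrans (congr1 (tens_map N u1) yz) uz.
rewrite -(exact_wbar_rho M0) => -[t _ ty].
by exists (sym2d_map u0 t), y, t.
Qed.

Hypothesis u10 : forall x, u0 (u1 x) = 0.

Lemma wbar_connects z q : connects u1 u0 z q -> wbar M q = 0.
Proof.
move=> [y [t [_ yt <-]]].
apply: etrans (esym (wbar_nat u0 t)) _.
apply: etrans (congr1 (gam2_map u0) (esym yt)) _.
exact: gam2_map_comp0.
Qed.

(** By linearity it suffices that z = 0 forces q = 0: then y = wbar(s), so
    injectivity of wbar on M0 gives t = S(u1)(s), which dies in S(M). *)
Lemma connects_uniq : (forall t, wbar M0 t = 0 -> t = 0) ->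
  forall z q q', connects u1 u0 z q -> connects u1 u0 z q' -> q = q'.
Proof.
move=> inj z q q' zq zq'; apply/eqP; rewrite -subr_eq0 addrC; apply/eqP.
have := connects_linear (-1) zq' zq; rewrite !scaleN1r addNr.
move=> [y [t [y0 yt <-]]].
have : [set v | rho M1 v = 0] y by [].
rewrite -(exact_wbar_rho M1) => -[s _ sy].
suff -> : t = sym2d_map u1 s by apply: sym2d_map_comp0.
apply/eqP; rewrite -subr_eq0; apply/eqP/inj.
apply: etrans (raddfB (wbar M0) t (sym2d_map u1 s)) _.
apply/eqP; rewrite subr_eq0; apply/eqP; apply: etrans (esym yt) _.
by rewrite -sy; apply: wbar_nat.
Qed.
End Fixed.

(** Lift q to t in S(M0).  Since wbar(t) is in the kernel of Gamma^2(u0), it comes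
    from Gamma^2(M1) after subtracting some z that does not affect q. *)
Lemma ker_wbar_connects (M M0 M1 : lmodType R) (u1 : {linear M1 -> M0})
    (u0 : {linear M0 -> M}) q : exact_at u1 u0 -> onto u0 -> wbar M q = 0 ->
  exists2 z, tens_map N u1 z = 0 & connects u1 u0 z q.
Proof.
move=> u10 u0_onto wq; have [t tq] := sym2d_map_onto u0_onto q.
have uwt : gam2_map u0 (wbar M0 t) = 0.
  by apply: etrans (wbar_nat u0 t) _; apply: etrans (congr1 (wbar M) tq) wq.
have [v [z [wt uz]]] := gam2_map_ker u10 u0_onto uwt.
have vE : gam2_map u1 v = wbar M0 (t - z).
  by apply: esym; apply: etrans (raddfB (wbar M0) t z) _; rewrite [X in X - _]wt addrK.
exists (rho M1 v).
  apply: etrans (rho_nat u1 v) _.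
  apply: etrans (congr1 (rho M0) vE) _.
  exact: (rho_wbar (t - z)).
exists v, (t - z); split=> //.
by apply: etrans (raddfB (sym2d_map u0) t z) _; rewrite [X in _ - X]uz subr0.
Qed.

Lemma aug_onto (M : lmodType R) : onto (aug M).
Proof. by move=> m; exists (fgen m); apply: free_liftE. Qed.

Lemma exact_bd1_aug (M : lmodType R) : exact_at (bd1 M) (aug M).
Proof.
apply: exact_atI => [|v av].
  pose o : {linear F1 M -> M} := \0.
  apply: (free_ext (f := aug M \o bd1 M) (g := o)) => k.
  apply: etrans (congr1 (aug M) (free_liftE (@kval _ _ _ (aug M)) k)) _.
  exact: (kvalP k).
by exists (fgen (mkker av)); apply: free_liftE.
Qed.

Lemma aug_bd1 (M : lmodType R) x : aug M (bd1 M x) = 0.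
Proof.
have : range (bd1 M) (bd1 M x) by exists x.
by rewrite (exact_bd1_aug M).
Qed.

Lemma bd1_bd2 (M : lmodType R) x : bd1 M (bd2 M x) = 0.
Proof.
pose o : {linear F2 M -> F0 M} := \0.
move: x; apply: (free_ext (f := bd1 M \o bd2 M) (g := o)) => k.
apply: etrans (congr1 (bd1 M) (free_liftE (@kval _ _ _ (bd1 M)) k)) _.
exact: (kvalP k).
Qed.

Lemma connects_canonical_uniq (M : lmodType R) z q q' :
  connects (bd1 M) (aug M) z q -> connects (bd1 M) (aug M) z q' -> q = q'.
Proof.
by apply: connects_uniq; [apply: aug_bd1 | apply: wbar_free_inj].
Qed.

(** The relation is a linear function on cycles of the functorial resolution; it
    kills boundaries because Gamma^2 turns the composite of bd2 and bd1 into 0. *)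
Lemma connecting_map (M : lmodType R) :
  exists tau : {linear tor1 N M -> sym2d M},
    forall z q, connects (bd1 M) (aug M) (kval z) q ->
      tau (qpi (@tor1_bound R N M) z) = q.
Proof.
have ex (z : kermod (tens_map N (bd1 M))) :
    {q | connects (bd1 M) (aug M) (kval z) q}.
  exact: cid (connects_exists (aug M) (kvalP z)).
pose t z : sym2d M := projT1 (ex z).
have tP z : connects (bd1 M) (aug M) (kval z) (t z).
  exact: (projT2 (ex z)).
have tE z q : connects (bd1 M) (aug M) (kval z) q -> t z = q.
  exact: connects_canonical_uniq.
have t_lin : linear t.
  by move=> a z z'; apply: tE; apply: connects_linear (tP z) (tP z').
pose mt := GRing.isLinear.Build R _ (sym2d M) _ t t_lin.
pose T : {linear kermod (tens_map N (bd1 M)) -> sym2d M} := HB.pack t mt.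
have t0 z : @tor1_bound R N M z -> T z = 0.
  move=> [y zy]; apply: tE; have [v vy] := rho_onto y.
  exists (gam2_map (bd2 M) v), 0; split.
  - apply: etrans (esym (rho_nat (bd2 M) v)) _.
    exact: etrans (congr1 (tens_map N (bd2 M)) vy) (esym zy).
  - apply: etrans (gam2_map_comp0 (@bd1_bd2 M) v) _.
    exact: esym (raddf0 (wbar (F0 M))).
  - exact: raddf0 (sym2d_map (aug M)).
exists (quo_lift t0) => z q zq.
exact: etrans (quo_liftE t0 z) (tE z q zq).
Qed.

End Connecting.

(** * The explicit formula *)

Section Formula.
Context (R : comPzRingType).

Lemma gamma11_sumr (M : lmodType R) (I : Type) (s : seq I) (x : I -> M) y :
  gamma11 y (\sum_(i <- s) x i) = \sum_(i <- s) gamma11 y (x i).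
Proof.
elim: s => [|i s IH]; last by rewrite !big_cons gamma11Dr IH.
by rewrite !big_nil -(scale0r 0) gamma11Zr scale0r.
Qed.

Lemma gamma2_sum (M : lmodType R) (disp : Order.disp_t) (I : orderType disp)
    (s : seq I) (x : I -> M) : uniq s ->
  gamma2 (\sum_(i <- s) x i) =
    \sum_(i <- s) gamma2 (x i) +
    \sum_(i <- s) \sum_(j <- s | (i < j)%O) gamma11 (x i) (x j).
Proof.
elim: s => [_|k s IH /= /andP[ks us]]; first by rewrite !big_nil gamma2_0 addr0.
rewrite !big_cons ltxx gamma2D {}IH // gamma11_sumr.
under [X in _ = _ + (_ + X)]eq_bigr do rewrite big_cons.
rewrite -!addrA; congr (_ + (_ + _)).
rewrite [RHS](_ : _ = \sum_(j <- s | (k < j)%O) gamma11 (x k) (x j) +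
  (\sum_(i <- s | (i < k)%O) gamma11 (x k) (x i) +
   \sum_(i <- s) \sum_(j <- s | (i < j)%O) gamma11 (x i) (x j))); last first.
  congr (_ + _); rewrite [X in _ = X + _]big_mkcond -big_split /=.
  by apply: eq_bigr => i _; case: ifP; rewrite ?add0r // gamma11C.
rewrite addrC addrA; congr (_ + _).
rewrite [X in _ = X + _]big_mkcond [X in _ = _ + X]big_mkcond -big_split /=.
apply: eq_big_seq => j js; case: (ltgtP k j) => [||kj]; rewrite ?addr0 ?add0r //.
by move: ks; rewrite kj js.
Qed.

(** Expanding gamma2 of a linear combination; the diagonal coefficient 2 s_i turns
    gamma2(e_i) into s_i gamma11(e_i, e_i), so everything is in the image of w. *)
Lemma gamma2_comb (M : lmodType R) (disp : Order.disp_t) (I : orderType disp)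
    (J : Type) (A : seq J) (B : seq I) (r : J -> R) (a : I -> J -> R) (s : I -> R)
    (e : I -> M) :
  uniq B -> (forall i, \sum_(j <- A) r j * a i j ^+ 2 = 2 * s i) ->
  \sum_(j <- A) r j *: gamma2 (\sum_(i <- B) a i j *: e i) =
  wmap (\sum_(i <- B) s i *: smk (e i) (e i) +
        \sum_(j <- A) \sum_(i <- B) \sum_(k <- B | (i < k)%O)
          (r j * a i j * a k j) *: smk (e i) (e k)).
Proof.
move=> uB rs; pose w : {linear sym2 M -> gam2 M} := @wmap R M.
have wE x y : w (smk x y) = gamma11 x y by apply: wmapE.
rewrite -[RHS]/(w _); move: w wE => w wE; rewrite linearD; symmetry.
transitivity (\sum_(i <- B) \sum_(j <- A) (r j * a i j ^+ 2) *: gamma2 (e i) +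
  \sum_(j <- A) \sum_(i <- B) \sum_(k <- B | (i < k)%O)
          (r j * a i j * a k j) *: gamma11 (e i) (e k)).
  congr (_ + _); rewrite linear_sum; apply: eq_bigr => i _.
    rewrite linearZ /= wE gamma11xx -scaler_suml rs.
    by rewrite -scaler_nat scalerA mulrC.
  rewrite linear_sum; apply: eq_bigr => j _.
  rewrite linear_sum; apply: eq_bigr => k _.
  by rewrite linearZ /= wE.
rewrite exchange_big -big_split /=; apply: eq_bigr => j _.
rewrite gamma2_sum // scalerDr !scaler_sumr; congr (_ + _); apply: eq_bigr => i _.
  by rewrite gamma2Z scalerA.
rewrite scaler_sumr; apply: eq_bigr => k _.
by rewrite gamma11Zl gamma11Zr !scalerA mulrA.
Qed.

Lemma fsbig_lt_pairs (V : nmodType) (disp : Order.disp_t) (I : orderType disp)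
    (B : {fset I}) (F : I * I -> V) :
  (forall p, F p <> 0 -> p.1 \in B /\ p.2 \in B) ->
  \sum_(p \in [set p : I * I | (p.1 < p.2)%O]) F p =
  \sum_(i <- B) \sum_(k <- B | (i < k)%O) F (i, k).
Proof.
move=> FB; pose s := [seq (i, k) | i <- B, k <- B].
have us : uniq s by apply: allpairs_uniq => // -[? ?] -[? ?].
rewrite (fsbigE [seq p <- s | (p.1 < p.2)%O]).
- rewrite big_filter_cond (eq_bigl (fun p => (p.1 < p.2)%O)); last first.
    by move=> p; apply: andb_idr => lt12; rewrite inE.
  rewrite big_mkcond big_allpairs.
  by apply: eq_bigr => i _; rewrite [RHS]big_mkcond.
- exact: filter_uniq.
- by move=> p /=; rewrite mem_filter => /andP[].
move=> p /= lt12 /negP ps; apply: contrapT => /FB[p1 p2]; apply: ps.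
rewrite mem_filter lt12; apply/allpairsP; exists p.
by rewrite -surjective_pairing.
Qed.

Lemma tens_coord (N : bimod R) (M : lmodType R) (c : {linear M -> R^o}) :
  exists f : {linear tens N M -> N}, forall n m, f (tmk n m) = ract n (c m).
Proof.
pose b (n : N) m := ract n (c m).
have bDl n n' m : b (n + n') m = b n m + b n' m by exact: ractDl.
have bDr n m m' : b n (m + m') = b n m + b n m' by rewrite /b linearD; exact: ractDr.
have bB n k m : b (ract n k) m = b n (k *: m) by rewrite /b linearZ /= ractA.
have bZ k n m : b (k *: n) m = k *: b n m by exact: ractZ.
exists (tens_lift bDl bDr bB bZ) => n m.
exact: (tens_liftE bDl bDr bB bZ).
Qed.

Lemma basis_coord (M : lmodType R) (I : choiceType) (e : I -> M) i :
  is_basis e ->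
  exists c : {linear M -> R^o}, forall k, c (e k) = (i == k)%:R.
Proof.
move=> [g gK Kg].
pose m := GRing.isLinear.Build R M _ _ g (can2_linear gK Kg).
pose g' : {linear M -> freemod R I} := HB.pack g m.
pose p (y : freemod R I) : R^o := y i.
pose mp := GRing.isLinear.Build R _ R^o _ p (coef_is_linear i).
pose p' : {linear freemod R I -> R^o} := HB.pack p mp.
exists (p' \o g') => k.
by rewrite -(free_liftE e k) /= gK; apply: coef_gen.
Qed.

Lemma range_mul2P (r : R) : rmod2 r = 0 -> exists s, r = 2 * s.
Proof.
move=> /qpi_eq0 /(smallest_submodule_id (range_submodule _)) [s _ <-].
by exists s; rewrite mulr_natl.
Qed.

(** The i-th coordinate of the image in N (x) M0 is the class of
    sum_j r_j a_ij^2 in R/2R, the square coming from the twisted right action. *)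
Lemma ker_even (M0 M1 : lmodType R) (u1 : {linear M1 -> M0}) (I J : choiceType)
    (e : I -> M0) (A : seq J) (B : seq I) (a : I -> J -> R) (v : J -> M1)
    (r : J -> R) i :
  is_basis e -> uniq B -> (forall j, j \in A -> i \notin B -> a i j = 0) ->
  (forall j, j \in A -> u1 (v j) = \sum_(k <- B) a k j *: e k) ->
  tens_map (Rmod2_tw R) u1
    (\sum_(j <- A) tmk (rmod2 (r j) : Rmod2_tw R) (v j)) = 0 ->
  exists s, \sum_(j <- A) r j * a i j ^+ 2 = 2 * s.
Proof.
move=> be uB aB uE; have [c cE] := basis_coord i be.
have [f fE] := tens_coord (Rmod2_tw R) c.
move=> /(congr1 f); rewrite linear0 => ux; apply: range_mul2P; rewrite -{}ux.
apply: etrans (raddf_sum (qpi (range (@mul2 R))) _ _ _) _.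
pose fu : {linear tens (Rmod2_tw R) M1 -> Rmod2_tw R} :=
  f \o tens_map (Rmod2_tw R) u1.
apply: etrans _ (esym (raddf_sum fu _ _ _)).
apply: eq_big_seq => j jA /=.
apply: etrans _ (esym (congr1 f (tens_mapE u1 _ _))).
apply: etrans _ (esym (fE _ _)); rewrite uE // linear_sum /=.
have -> : \sum_(k <- B) c (a k j *: e k) = a i j.
  transitivity (\sum_(k <- B) if k == i then a i j else 0).
    apply: eq_bigr => k _; rewrite linearZ /= cE eq_sym.
    by case: eqP => [->|_]; [apply: mulr1 | apply: mulr0].
  rewrite -big_mkcond /=; have [iB|iB] := boolP (i \in B).
    by rewrite -big_filter filter_pred1_uniq // big_seq1.
  rewrite big_seq_cond big1 => [|k /andP[kB /eqP ki]]; first by rewrite aB.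
  by rewrite -ki kB in iB.
by rewrite mulrC; apply: qpiZ.
Qed.

(** The lift of sum_j r_j (x) v_j along rho is sum_j r_j gamma2(v_j), and
    [gamma2_comb] exhibits its image in Gamma^2(M0) as an element wbar(t). *)
Lemma connects_formula (M M0 M1 : lmodType R) (u1 : {linear M1 -> M0})
    (u0 : {linear M0 -> M}) (disp : Order.disp_t) (I : orderType disp) (J : choiceType)
    (e : I -> M0) (v : J -> M1) (A : seq J) (B : seq I) (a : I -> J -> R)
    (r : J -> R) (s : I -> R) :
  uniq B -> (forall i, \sum_(j <- A) r j * a i j ^+ 2 = 2 * s i) ->
  (forall j, j \in A -> u1 (v j) = \sum_(k <- B) a k j *: e k) ->
  connects u1 u0 (\sum_(j <- A) tmk (rmod2 (r j) : Rmod2_tw R) (v j))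
    (\sum_(i <- B) spi (s i *: smk (u0 (e i)) (u0 (e i))) +
     spi (\sum_(j <- A) \sum_(i <- B) \sum_(k <- B | (i < k)%O)
          (r j * a i j * a k j) *: smk (u0 (e i)) (u0 (e k)))).
Proof.
move=> uB rs uE; exists (\sum_(j <- A) r j *: gamma2 (v j)).
exists (spi (\sum_(i <- B) s i *: smk (e i) (e i) +
        \sum_(j <- A) \sum_(i <- B) \sum_(k <- B | (i < k)%O)
          (r j * a i j * a k j) *: smk (e i) (e k))); split.
- apply: etrans (raddf_sum (rho M1) _ _ _) _.
  by apply: eq_bigr => j _; rewrite tmk_rmod2.
- apply: etrans _ (esym (wbarE _)); apply: etrans _ (gamma2_comb e uB rs).
  apply: etrans (raddf_sum (gam2_map u1) _ _ _) _.
  apply: eq_big_seq => j jA; rewrite -uE //.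
  apply: etrans (linearZ_LR (gam2_map u1) (r j) (gamma2 (v j))) _.
  by congr (_ *: _); apply: gam2_mapE.
apply: etrans (sym2d_map_spi _ _) _.
rewrite -(raddf_sum (@spi R M)) -(raddfD (@spi R M)); congr (spi _).
pose f : {linear sym2 M0 -> sym2 M} := sym2_map u0.
have fE x y : f (smk x y) = smk (u0 x) (u0 y) by apply: sym2_mapE.
rewrite -[LHS]/(f _); move: f fE => f fE; rewrite linearD.
congr (_ + _); rewrite linear_sum; apply: eq_bigr => i _.
  by rewrite linearZ /= fE.
rewrite linear_sum; apply: eq_bigr => j _.
rewrite linear_sum; apply: eq_bigr => k _.
by rewrite linearZ /= fE.
Qed.

End Formula.

(** * The exact sequence *)

Theorem theorem2p3 (R : comPzRingType) :
  exists tau : forall M : lmodType R, {linear tor1 (Rmod2_tw R) M -> sym2d M},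
    (forall M : lmodType R,
      [/\ exact_at (tau M) (wbar M),
          exact_at (wbar M) (rho M) &
          onto (rho M)]) /\
    (forall (M M' : lmodType R) (g : {linear M -> M'}),
      [/\ sym2d_map g \o tau M =1 tau M' \o tor1_map (Rmod2_tw R) g,
          gam2_map g \o wbar M =1 wbar M' \o sym2d_map g &
          tens_map (Rmod2_tw R) g \o rho M =1 rho M' \o gam2_map g]) /\
    (forall (M M0 M1 : lmodType R)
        (u1 : {linear M1 -> M0}) (u0 : {linear M0 -> M}),
      exact_at u1 u0 -> onto u0 ->
      forall (disp : Order.disp_t) (I : orderType disp) (J : choiceType)
        (e : I -> M0) (e' : J -> M1),
      is_basis e -> is_basis e' ->
      forall a : I -> J -> R,
      (forall j, fin_supp (a ^~ j)) ->
      (forall j, u1 (e' j) = \sum_(i \in [set: I]) a i j *: e i) ->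
      forall (r : J -> R) (x : kermod (tens_map (Rmod2_tw R) u1)),
      fin_supp r ->
      kval x = \sum_(j \in [set: J]) tmk (rmod2 (r j) : Rmod2_tw R) (e' j) ->
      (forall i, exists s : R,
        \sum_(j \in [set: J]) r j * a i j ^+ 2 = 2 * s) /\
      (forall s : I -> R,
        (forall i, \sum_(j \in [set: J]) r j * a i j ^+ 2 = 2 * s i) ->
        fin_supp (fun i => spi (s i *: smk (u0 (e i)) (u0 (e i)))) /\
        (forall (f0 : {linear M0 -> F0 M}) (f1 : {linear M1 -> F1 M})
            (augf0 : aug M \o f0 =1 u0) (bd1f1 : bd1 M \o f1 =1 f0 \o u1),
          tau M (tor1_class bd1f1 x) =
            \sum_(i \in [set: I]) spi (s i *: smk (u0 (e i)) (u0 (e i))) +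
            spi (\sum_(j \in [set: J])
                   \sum_(p \in [set p : I * I | (p.1 < p.2)%O])
                     (r j * a p.1 j * a p.2 j) *:
                       smk (u0 (e p.1)) (u0 (e p.2)))))).
Proof.
have tau_ex M := cid (@connecting_map R M).
pose tau M : {linear tor1 (Rmod2_tw R) M -> sym2d M} := projT1 (tau_ex M).
have tauP M z q : connects (bd1 M) (aug M) (kval z) q -> tau M (qpi _ z) = q.
  exact: projT2 (tau_ex M) z q.
exists tau; split; [|split].
- move=> M; split; [apply: exact_atI | exact: exact_wbar_rho | exact: rho_onto].
    move=> x; have [z <-] := qpiP x.
    have [q zq] := connects_exists (aug M) (kvalP z).
    by rewrite (tauP _ _ _ zq); apply: wbar_connects zq; apply: aug_bd1.
  move=> q wq.
  have [z uz zq] := ker_wbar_connects (@exact_bd1_aug R M) (@aug_onto R M) wq.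
  by exists (qpi _ (mkker uz)); apply: tauP.
- move=> M M' g; split; [|exact: wbar_nat|exact: rho_nat].
  (* Both sides are read off from the same connecting data, transported by the
     chain map that g induces on the functorial resolutions. *)
  move=> x; have [z <-] := qpiP x.
  have [q zq] := connects_exists (aug M) (kvalP z).
  apply: etrans (congr1 (sym2d_map g) (tauP _ _ _ zq)) _.
  apply: esym; apply: etrans (congr1 (tau M') (quo_liftE _ z)) _.
  by apply: tauP; apply: connects_map zq; [exact: bd1_nat | exact: aug_nat].
(* All the finitely supported sums are taken over A, the support of r, and B, the
   rows that meet the columns in A. *)
move=> M M0 M1 u1 u0 _ _ disp I J e e' be be' a fa u1E r x fr xE.
have [A rA] : exists A : {fset J}, [set j | r j <> 0] = [set` A].
  by apply/finite_fsetP.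
have [B aB] : exists B : {fset I},
    \bigcup_(j in [set` A]) [set i | a i j <> 0] = [set` B].
  apply/finite_fsetP; apply: bigcup_finite => // j _; exact: fa.
have r0 j : j \notin A -> r j = 0.
  move=> /negP jA; apply: contrapT => rj; apply: jA.
  by have : [set` A] j by rewrite -rA.
have a0 i j : j \in A -> i \notin B -> a i j = 0.
  move=> jA /negP iB; apply: contrapT => aij; apply: iB.
  by have : [set` B] i by rewrite -aB; exists j.
have {}u1E j : j \in A -> u1 (e' j) = \sum_(i <- B) a i j *: e i.
  move=> jA; rewrite u1E; apply: fsbigTE => i iB.
  by rewrite a0 // scale0r.
have {}xE : kval x = \sum_(j <- A) tmk (rmod2 (r j) : Rmod2_tw R) (e' j).
  rewrite xE; apply: fsbigTE => j jA.
  by apply: etrans (tmk_rmod2 _ _) _; rewrite r0 // scale0r; apply: linear0.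
have sumA i : \sum_(j \in [set: J]) r j * a i j ^+ 2 =
    \sum_(j <- A) r j * a i j ^+ 2.
  by apply: fsbigTE => j jA; rewrite r0 // mul0r.
split=> [i|s].
  rewrite sumA; apply: (ker_even be (fset_uniq B) _ u1E); first by move=> j jA; apply: a0.
  by rewrite -xE; apply: kvalP.
move=> rs.
have {sumA}rs i : \sum_(j <- A) r j * a i j ^+ 2 = 2 * s i by rewrite -sumA.
(* Outside B the scalar s_i need not vanish, but 2 s_i = 0. *)
have s0 i : i \notin B -> spi (s i *: smk (u0 (e i)) (u0 (e i))) = 0.
  move=> iB; apply: spi_tors2; rewrite -rs big_seq big1 // => j jA.
  by rewrite a0 // expr0n mulr0.
split=> [|f0 f1 augf0 bd1f1].
  apply: (sub_finite_set _ (finite_fset B)) => i /= si.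
  by apply: contrapT => /negP iB; apply: si; apply: s0.
apply: tauP.
rewrite [X in _ + spi X](fsbigTE A) => [|j jA]; last first.
  by apply: fsbig1 => p _; rewrite r0 // !mul0r scale0r.
rewrite [X in X + _](fsbigTE B) //.
rewrite (eq_big_seq (fun j => \sum_(i <- B) \sum_(k <- B | (i < k)%O)
    (r j * a i j * a k j) *: smk (u0 (e i)) (u0 (e k)))) => [|j jA]; last first.
  apply: (fsbig_lt_pairs (B := B)) => -[i k] /= nz; split; apply: contrapT => /negP nB.
    by apply: nz; rewrite (a0 i) // mulr0 mul0r scale0r.
  by apply: nz; rewrite (a0 k) // mulr0 scale0r.
(* A comparison map (f1, f0) over the identity of M carries the connecting data
   to the functorial resolution. *)
have := connects_formula u0 (fset_uniq B) rs u1E.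
rewrite -{}xE => /(connects_map (g := idfun) bd1f1 augf0).
by rewrite sym2d_map_id.
Qed.
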